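(* Let $X$ be a finite polyhedron and let $\xi\in H^1(X;\mathbb{Z})$ be an integral cohomology class. Let $\Phi:X\times\mathbb{R}\to X$ be a continuous flow such that the set $R_\xi=R_\xi(\Phi)$ is isolated in the chain recurrent set $R=R(\Phi)$, and let $C_\xi=R-R_\xi$. Then the following two conditions are equivalent: (B) there exist constants $\delta>0$, $T>1$ such that every homology class $z\in H_1(X;\mathbb{Z})$ associated to an arbitrary $(\delta,T)$-cycle $(x,t)$ with $x\in C_\xi$ satisfies $\langle\xi,z\rangle\le-1$; (Fried's condition) any homology direction $\tilde z=\lim\tilde z_n\in D_X$ of any closing sequence $(x_n,t_n)\in X\times(1,\infty)$ with $x_n\in C_\xi$ satisfies $\langle\xi,\tilde z\rangle<0$.
   Context: Write $x\cdot t=\Phi(x,t)$ and let $d$ be a metric on $X$. $\langle\xi,z\rangle$ is the evaluation of $\xi$ on $z\in H_1(X;\mathbb{Z})$ (or on $z \in H_1(X;\mathbb{R})$). Isolated: $R_\xi$ is isolated in $R$ if some neighborhood of $R_\xi$ meets $R$ only in $R_\xi$, i.e. $C_\xi$ is closed. Chains. A $(\delta,T)$-chain from $x$ to $y$ is a sequence $x_0=x,x_1,\dots,x_N=y$ in $X$ with $t_1,\dots,t_N\in\mathbb{R}$ such that $t_i\ge T$ and $d(x_{i-1}\cdot t_i,x_i)<\delta$ for $1\le i\le N$. It is closed if $x=y$. A $(\delta,T)$-cycle is a pair $(x,t)\in X\times\mathbb{R}$ with $t\ge T$ and $d(x,x\cdot t)<\delta$, i.e. a closed chain with $N=1$. $R(\Phi)$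 is the set of $x\in X$ such that for all $\delta>0$, $T\ge1$ there is a $(\delta,T)$-chain from $x$ to $x$. Scale and associated classes. A scale of $\xi$ is a pair $(\varepsilon,\delta_0)$ of positive numbers such that $\xi|_B=0$ for every ball $B\subset X$ of radius $2\varepsilon$ (with $\xi$ viewed in $\check H^1(X;\mathbb{R})$), and any $x,y\in X$ with $d(x,y)<\delta_0$ can be joined by a path contained in a ball of radius $\varepsilon$. Fix a scale. A homology class $z\in H_1(X;\mathbb{Z})$ is associated with a closed $(\delta,T)$-chain if it is represented by the singular cycle obtained by concatenating the trajectory pieces from $x_{i-1}$ to $x_{i-1}\cdot t_i$ with paths $\sigma_i$ from $x_{i-1}\cdot t_i$ to $x_i$, each lying in some ball of radius $\varepsilon$. The number $\langle\xi,z\rangle$ does not depend on the choice of the $\sigma_i$. The set $R_\xi$. $R_\xi(\Phi)$ is the set of $x\in X$ such that for any $0<\delta'<\delta_0$ and $T>1$ there is a $(\delta',T)$-chain from $x$ to $x$ with $\langle\xi,z\rangle=0$ for any homology class $z$ associated with this chain. It is a closed flow-invariant subset of $R(\Phi)$. Homology directions. $D_X=H_1(X;\mathbb{R})/\mathbb{R}_+$ (quotient by multiplication by positive reals), topologized as the disjoint union of the unit sphere (for some norm) with the origin. The sign of $\langle\xi,\tilde z\rangle$ is well defined for $\tilde z\in D_X$. A sequence $(x_n,t_n)\in X\times(1,\infty)$ is a closing sequence based at $x\in X$ if both $x_n$ and $x_n\cdot t_n$ tend to $x$. It determines (for $n$ large) homology classes $z_n\in H_1(X;\mathbb{Z})$: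 $z_n$ is the class of a loop which starts at $x_n$, follows the flow until $x_n\cdot t_n$, and returns to $x_n$ along a short path. $\tilde z_n\in D_X$ is the equivalence class of $z_n$. A homology direction of the closing sequence is an accumulation point of $(\tilde z_n)$ in $D_X$ (a limit $\lim\tilde z_n$, after passing to a subsequence). *)

(* Defs.v *)
From HB Require Import structures.
From mathcomp Require Import all_boot all_order all_algebra.
From mathcomp Require Import generic_quotient ring_quotient freeg.
From mathcomp Require Import all_classical reals topology normedtype.

Set Implicit Arguments.
Unset Strict Implicit.
Unset Printing Implicit Defensive.

Import Order.TTheory GRing.Theory Num.Theory.
Import numFieldNormedType.Exports.

Local Open Scope classical_set_scope.
Local Open Scope ring_scope.
Local Open Scope quotient_scope.

Section ModuleHomology.
Variables (A : nzRingType) (U V W : lmodType A).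
Variables (f : {linear U -> V}) (g : {linear V -> W}).

Definition lker_pred : {pred V} := fun v => g v == 0.

Lemma lker_pred_closed : submod_closed lker_pred.
Proof.
split=> [|a u v]; rewrite !unfold_in ?linear0 //.
by move=> /eqP u0 /eqP v0; rewrite linearP u0 v0 scaler0 addr0.
Qed.

HB.instance Definition _ := GRing.isSubmodClosed.Build A V lker_pred
  lker_pred_closed.

Record lkernel := LKernel { lkval :> V ; lkvalP : lkval \in lker_pred }.

HB.instance Definition _ := [isSub for lkval].
HB.instance Definition _ := [Choice of lkernel by <:].
HB.instance Definition _ := [SubChoice_isSubLmodule of lkernel by <:].

(* No assumption g \o f = 0: the image is taken inside the kernel of g. *)
Definition limage_pred : {pred lkernel} := fun v => `[< exists u, f u = lkval v >].

Lemma limage_pred_closed : submod_closed limage_pred.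
Proof.
split=> [|a u v]; rewrite !unfold_in; first by apply/asboolP; exists 0; rewrite linear0.
move=> /asboolP[u' fu] /asboolP[v' fv]; apply/asboolP.
by exists (a *: u' + v'); rewrite linearP /= fu fv.
Qed.

HB.instance Definition _ := GRing.isSubmodClosed.Build A lkernel limage_pred
  limage_pred_closed.

Definition homology := Quotient.quot limage_pred.

HB.instance Definition _ := GRing.Zmodule.on homology.
HB.instance Definition _ := ZmodQuotient.on homology.

Definition homology_scale (a : A) (z : homology) : homology :=
  \pi_homology (a *: repr z).

Lemma pi_homology_eq (u v : lkernel) :
  (\pi_homology u == \pi_homology v) = (u - v \in limage_pred).
Proof. by rewrite piE. Qed.

Lemma pi_homologyZ a u :
  homology_scale a (\pi_homology u) = \pi_homology (a *: u).
Proof.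
apply/eqP; rewrite pi_homology_eq -scalerBr rpredZ //.
by rewrite -pi_homology_eq reprK.
Qed.

Lemma homology_scaleA a b z :
  homology_scale a (homology_scale b z) = homology_scale (a * b) z.
Proof. by elim/quotW: z => z; rewrite (pi_homologyZ b) !pi_homologyZ scalerA. Qed.

Lemma homology_scale1 : left_id 1 homology_scale.
Proof. by elim/quotW=> z; rewrite pi_homologyZ scale1r. Qed.

Lemma homology_scaleDr : right_distributive homology_scale +%R.
Proof.
move=> a; elim/quotW=> y; elim/quotW=> z.
by rewrite -raddfD !pi_homologyZ scalerDr raddfD.
Qed.

Lemma homology_scaleDl z : {morph homology_scale^~ z : a b / a + b}.
Proof.
by elim/quotW: z => z a b; rewrite !pi_homologyZ scalerDl raddfD.
Qed.

HB.instance Definition _ := GRing.Zmodule_isLmodule.Build A homology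
  homology_scaleA homology_scale1 homology_scaleDr homology_scaleDl.

End ModuleHomology.

Section FreeLift.
Variables (A : nzRingType) (K : choiceType) (M : lmodType A) (f : K -> M).

Lemma scale_freegU (a b : A) (x : K) : a *: << b *g x >> = << a * b *g x >>.
Proof. by apply/eqP/freeg_eqP => k; rewrite coeffZ !coeffU mulrA. Qed.

Lemma fglift_is_linear : linear (fglift f).
Proof.
have addf : {morph fglift f : x y / x + y}.
  move=> x y; have fB := lift_is_additive f.
  have f0 : fglift f 0 = 0 by rewrite -[0 in LHS](subrr 0) fB subrr.
  by rewrite -{1}[y]opprK fB -[- y]sub0r fB f0 sub0r opprK.
have f0 : fglift f 0 = 0 by apply/(addrI (fglift f 0)); rewrite -addf !addr0.
move=> a x y; rewrite addf; congr (_ + _).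
rewrite -[x]freeg_sumE scaler_sumr.
rewrite !(big_morph (fglift f) addf f0) scaler_sumr.
apply: eq_bigr => z _; by rewrite scale_freegU !liftU scalerA.
Qed.

HB.instance Definition _ := GRing.isLinear.Build A {freeg K / A} M *:%R
  (fglift f) fglift_is_linear.

End FreeLift.

Section SingularSimplices.
Variable R : realType.

Definition simplex n : set 'rV[R]_n.+1 :=
  [set v | (forall i, 0 <= v 0 i) /\ \sum_i v 0 i = 1].
Arguments simplex : clear implicits.

Definition coface_row n (i : 'I_n.+2) (v : 'rV[R]_n.+1) : 'rV[R]_n.+2 :=
  \row_j (if unlift i j is Some k then v 0 k else 0).

Lemma coface_row_simplex n (i : 'I_n.+2) (v : simplex n) :
  coface_row i (val v) \in simplex n.+1.
Proof.
have [v0 v1] := set_mem (valP v); apply/mem_set; split=> [j|].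
  by rewrite mxE; case: unliftP.
rewrite (bigD1_ord i) //= mxE unlift_none add0r -[RHS]v1.
by apply: eq_bigr => k _; rewrite mxE liftK.
Qed.

Definition coface n (i : 'I_n.+2) (v : simplex n) : simplex n.+1 :=
  SigSub (coface_row_simplex i v).

Lemma continuous_coface n (i : 'I_n.+2) : continuous (@coface n i).
Proof.
apply: (@continuous_comp_initial _ _ _ set_val) => v S.
move=> /= /nbhs_ballP[e e0 eS].
apply: (@filterS _ _ (nbhs_filter v) _ _ _
  (@initial_continuous _ _ set_val v _ (nbhsx_ballx (set_val v) e e0))).
move=> w [_ vw]; apply: eS; split=> // k j; rewrite ord1 !mxE.
by case: unliftP => [l _|_]; [exact: vw|exact: ballxx].
Qed.

HB.instance Definition _ n (i : 'I_n.+2) :=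
  isContinuous.Build (simplex n) (simplex n.+1) (@coface n i)
    (@continuous_coface n i).

Lemma vertex_simplex n (i : 'I_n.+1) : delta_mx 0 i \in simplex n.
Proof.
apply/mem_set; split=> [j|]; first by rewrite mxE ler0n.
rewrite (bigD1 i) //= mxE !eqxx big1 ?addr0 // => j /negPf ji.
by rewrite mxE ji.
Qed.

Definition vertex n (i : 'I_n.+1) : simplex n := SigSub (vertex_simplex i).

Definition singular (X : topologicalType) n := continuousType (simplex n) X.

Definition face (X : topologicalType) n (i : 'I_n.+2) (s : singular X n.+1) :
  singular X n := s \o @coface n i.

End SingularSimplices.
Arguments simplex : clear implicits.
Arguments singular : clear implicits.

Section SingularHomology.
Variables (R : realType) (X : topologicalType).

Definition chain (A : nzRingType) n := {freeg (singular R X n) / A}.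

HB.instance Definition _ (A : nzRingType) n := GRing.Lmodule.on (chain A n).

Definition boundary_simplex (A : nzRingType) n (s : singular R X n.+1) :
  chain A n := \sum_(i < n.+2) << (-1) ^+ i *g face i s >>.

Definition boundary (A : nzRingType) n : chain A n.+1 -> chain A n :=
  fglift (@boundary_simplex A n).

HB.instance Definition _ (A : nzRingType) n :=
  GRing.isLinear.Build A (chain A n.+1) (chain A n) *:%R (@boundary A n)
    (fglift_is_linear _).

Lemma boundaryU (A : nzRingType) n a (s : singular R X n.+1) :
  boundary << a *g s >> = a *: boundary_simplex A s.
Proof. exact: liftU. Qed.

Definition cycle1 (A : nzRingType) := lkernel (@boundary A 0).
Definition homology1 (A : nzRingType) := homology (@boundary A 1) (@boundary A 0).

Definition cochain n := singular R X n -> int^o.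

HB.instance Definition _ n := GRing.Lmodule.on (cochain n).

Definition coboundary n (c : cochain n) : cochain n.+1 :=
  fun s => \sum_(i < n.+2) (-1) ^+ i * c (face i s).

Lemma coboundary_is_linear n : linear (@coboundary n).
Proof.
move=> a c c'; apply/funext => s.
rewrite -[RHS]/(a * coboundary c s + coboundary c' s) mulr_sumr -big_split.
by apply: eq_bigr => i _; rewrite mulrCA; exact: mulrDr.
Qed.

HB.instance Definition _ n :=
  GRing.isLinear.Build int (cochain n) (cochain n.+1) *:%R (@coboundary n)
    (@coboundary_is_linear n).

Definition cohomology1 := homology (@coboundary 0) (@coboundary 1).

Definition cochain_eval (A : nzRingType) n (c : cochain n) (z : chain A n) : A :=
  fglift (fun s => (c s)%:~R : A^o) z.

(* Independent of the representatives by pairing_pi below. *)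
Definition pairing (A : nzRingType) (xi : cohomology1) (z : homology1 A) : A :=
  cochain_eval (lkval (repr xi)) (lkval (repr z)).

Definition extend_coeff (A : nzRingType) n (z : chain int n) : chain A n :=
  fglift (fun s => << s >> : zmodule {freeg (singular R X n) / A}) z.

Lemma extend_coeffU (A : nzRingType) n a (s : singular R X n) :
  extend_coeff A << a *g s >> = << a%:~R *g s >>.
Proof.
rewrite /extend_coeff liftU.
by rewrite -[LHS]/(_ *~ _) freegU_mulz.
Qed.

Lemma extend_coeff_is_zmod_morphism (A : nzRingType) n :
  zmod_morphism (@extend_coeff A n).
Proof. by move=> x y; rewrite /extend_coeff linearB. Qed.

HB.instance Definition _ (A : nzRingType) n :=
  GRing.isZmodMorphism.Build (chain int n) (chain A n) (@extend_coeff A n)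
    (@extend_coeff_is_zmod_morphism A n).

Lemma boundary_extend_coeff (A : nzRingType) n (z : chain int n.+1) :
  boundary (extend_coeff A z) = extend_coeff A (boundary z).
Proof.
rewrite -[z]freeg_sumE !raddf_sum; apply: eq_bigr => s _ /=.
rewrite extend_coeffU !boundaryU !scaler_sumr raddf_sum; apply: eq_bigr => i _.
by rewrite /= !scale_freegU extend_coeffU intrM rmorph_sign.
Qed.


Lemma extend_cycle_subproof (A : nzRingType) (z : cycle1 int) :
  extend_coeff A (lkval z) \in lker_pred (@boundary A 0).
Proof.
have /eqP z0 := lkvalP z.
by apply/eqP; apply: etrans (boundary_extend_coeff A (lkval z)) _; rewrite z0 raddf0.
Qed.

Definition extend_cycle (A : nzRingType) (z : cycle1 int) : cycle1 A :=
  LKernel (extend_cycle_subproof A z).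

Definition extend_class (A : nzRingType) (z : homology1 int) : homology1 A :=
  \pi_(homology1 A) (extend_cycle A (repr z)).

Lemma cochain_eval_coboundary (A : nzRingType) n (c : cochain n)
    (z : chain A n.+1) :
  cochain_eval (coboundary c) z = cochain_eval c (boundary z).
Proof.
rewrite -[z]freeg_sumE raddf_sum /= /cochain_eval !linear_sum.
apply: eq_bigr => s _; rewrite [LHS]liftU boundaryU [RHS]linearZ /=.
apply: (congr1 (fun y : A => coeff s z * y)).
rewrite linear_sum raddf_sum; apply: eq_bigr => i _.
by rewrite [RHS]liftU /= intrM rmorph_sign.
Qed.

Lemma cochain_evalBl (A : nzRingType) n (c c' : cochain n) (z : chain A n) :
  cochain_eval (c - c') z = cochain_eval c z - cochain_eval c' z.
Proof.
rewrite -[z]freeg_sumE /cochain_eval !linear_sum -sumrB.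
apply: eq_bigr => s _; rewrite /= !liftU.
apply: etrans (mulrBr (coeff s z) (c s)%:~R (c' s)%:~R).
by rewrite -intrB.
Qed.

Lemma cochain_evalBr (A : nzRingType) n (c : cochain n) (z z' : chain A n) :
  cochain_eval c (z - z') = cochain_eval c z - cochain_eval c z'.
Proof. exact: (lift_is_additive (fun s => (c s)%:~R : A^o)). Qed.

Lemma pairing_pi (A : nzRingType) (c : lkernel (@coboundary 1))
    (z : cycle1 A) :
  pairing (\pi_cohomology1 c) (\pi_(homology1 A) z) = cochain_eval (lkval c) (lkval z).
Proof.
have /asboolP[b cb] : repr (\pi_cohomology1 c) - c \in 
    limage_pred (@coboundary 0) (g := @coboundary 1).
  by rewrite -pi_homology_eq reprK.
have /asboolP[w zw] : repr (\pi_(homology1 A) z) - z \in 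
    limage_pred (@boundary A 1) (g := @boundary A 0).
  by rewrite -pi_homology_eq reprK.
have e0 n (e : cochain n) : cochain_eval e (0 : chain A n) = 0.
  by rewrite -[X in cochain_eval _ X](subrr 0) cochain_evalBr subrr.
have e0l n (x : chain A n) : cochain_eval (0 : cochain n) x = 0.
  by rewrite -[X in cochain_eval X](subrr 0) cochain_evalBl subrr.
apply/eqP; rewrite /pairing -subr_eq0.
set c' := repr _ in cb *; set z' := repr _ in zw *.
have -> : cochain_eval (lkval c') (lkval z') =
    cochain_eval (lkval c' - lkval c) (lkval z') +
    cochain_eval (lkval c) (lkval z' - lkval z) + cochain_eval (lkval c) (lkval z).
  by rewrite cochain_evalBl cochain_evalBr addrA subrK subrK.
have -> : lkval c' - lkval c = coboundary b by rewrite cb.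
have -> : lkval z' - lkval z = boundary w by rewrite zw.
rewrite addrK cochain_eval_coboundary -(cochain_eval_coboundary (lkval c)).
by rewrite (eqP (lkvalP z')) (eqP (lkvalP c)) e0 e0l addr0.
Qed.

End SingularHomology.
Arguments homology1 : clear implicits.
Arguments cohomology1 : clear implicits.

Section Polyhedron.
Variable R : realType.

Definition simplicial_complex m (K : {set {set 'I_m}}) :=
  (forall S, S \in K -> (0 < #|S|)%N) /\
  (forall S T : {set 'I_m}, S \in K -> T \subset S -> (0 < #|T|)%N -> T \in K).

(* Barycentric coordinates: v is the point of the open simplex spanned by its
   support. *)
Definition realization m (K : {set {set 'I_m}}) : set 'rV[R]_m :=
  [set v | [/\ forall i, 0 <= v 0 i, \sum_i v 0 i = 1 &
    finset (fun i => v 0 i != 0) \in K]].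

Definition finite_polyhedron (X : topologicalType) :=
  exists m (K : {set {set 'I_m}}) (f : X -> realization K)
    (g : realization K -> X),
    [/\ simplicial_complex K, continuous f, continuous g, cancel f g &
      cancel g f].

End Polyhedron.
Arguments finite_polyhedron : clear implicits.

Section Rays.
Variables (R : realType) (V : lmodType R).

Definition same_ray (u v : V) : bool := `[< exists2 a : R, 0 < a & v = a *: u >].

Lemma same_ray_refl : reflexive same_ray.
Proof. by move=> u; apply/asboolP; exists 1; rewrite ?scale1r. Qed.

Lemma same_ray_sym : symmetric same_ray.
Proof.
have sym u v : same_ray u v -> same_ray v u.
  move=> /asboolP[a a0 ->]; apply/asboolP; exists a^-1; rewrite ?invr_gt0 //.
  by rewrite scalerA mulVf ?scale1r // gt_eqF.
by move=> u v; apply/idP/idP; exact: sym.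
Qed.

Lemma same_ray_trans : transitive same_ray.
Proof.
move=> v u w /asboolP[a a0 ->] /asboolP[b b0 ->]; apply/asboolP.
by exists (b * a); rewrite ?mulr_gt0 // scalerA.
Qed.

Canonical same_ray_equiv := EquivRel same_ray same_ray_refl same_ray_sym
  same_ray_trans.

Definition ray := {eq_quot same_ray}.

HB.instance Definition _ := EqQuotient.on ray.
HB.instance Definition _ := Choice.on ray.

Definition is_norm (N : V -> R) :=
  [/\ forall u v, N (u + v) <= N u + N v,
      forall a u, N (a *: u) = `|a| * N u &
      forall u, N u = 0 -> u = 0].

(* The representative of a ray on the unit sphere of N; the ray of 0 has
   representative 0, as 0^-1 = 0.  The distance from 0 to the unit sphere is 1,
   so the metric of N on these representatives gives the disjoint union of the
   unit sphere and the origin. *)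
Definition unit_repr (N : V -> R) (r : ray) : V := (N (repr r))^-1 *: repr r.

Definition cvg_ray (N : V -> R) (r : nat -> ray) (l : ray) :=
  N (unit_repr N (r n) - unit_repr N l) @[n --> \oo] --> (0 : R).

End Rays.

Section CechRestriction.
Variables (R : realType) (X : topologicalType).

Definition source (s : singular R X 1) : X := s (vertex R ord0).
Definition target (s : singular R X 1) : X := s (vertex R ord_max).

Definition locally_constant_on (U : set X) (h : X -> R) :=
  forall x, U x -> \forall y \near x, U y -> h y = h x.

(* For B open, the class in the Cech cohomology H^1(B; R) corresponding to a
   singular cocycle c is computed in the Cech-singular double complex: choose
   an open cover (U i) of B and primitives f i of c on U i; the class is
   represented by the locally constant functions g i j = f j - f i. *)
Definition cech_representative (c : cochain R X 1) (B : set X) (I : Type)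
    (U : I -> set X) (g : I -> I -> X -> R) :=
  [/\ forall i, open (U i), \bigcup_i U i = B,
      forall i j, locally_constant_on (U i `&` U j) (g i j) &
      exists f : I -> X -> R,
        (forall i (s : singular R X 1), range s `<=` U i ->
          (c s)%:~R = f i (target s) - f i (source s)) /\
        (forall i j x, U i x -> U j x -> g i j x = f j x - f i x)].

Definition cech_coboundary (I : Type) (U : I -> set X) (g : I -> I -> X -> R) :=
  exists h : I -> X -> R,
    (forall i, locally_constant_on (U i) (h i)) /\
    (forall i j x, U i x -> U j x -> g i j x = h j x - h i x).

(* No refinement of U is needed: a Cech representative on U restricts to one on
   any finer cover. *)
Definition cech_restriction_eq0 (xi : cohomology1 R X) (B : set X) :=
  exists (I : Type) (U : I -> set X) (g : I -> I -> X -> R),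
    cech_representative (lkval (repr xi)) B U g /\ cech_coboundary U g.

End CechRestriction.

Record flow (R : realType) (X : topologicalType) := Flow {
  flow_map :> X * R -> X ;
  flow_continuous : continuous flow_map ;
  flow0 : forall x, flow_map (x, 0) = x ;
  flowD : forall x s t, flow_map (x, s + t) = flow_map (flow_map (x, s), t)
}.

Section Trajectory.
Variables (R : realType) (X : topologicalType) (Phi : flow R X).
Variables (x : X) (t : R).

(* The second barycentric coordinate is the parameter in [0, 1], so this runs
   from x to x . t. *)
Definition trajectory_map (v : simplex R 1) : X := Phi (x, set_val v 0 ord_max * t).

Lemma trajectory_map_continuous : continuous trajectory_map.
Proof.
pose c (w : simplex R 1) : R := (set_val w : 'rV[R]_2) 0 ord_max.
move=> v; apply: (@continuous_comp _ _ _ (fun w => (x, c w * t)) Phi).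
  have fv : Filter (nbhs v) := nbhs_filter v.
  have hv : c w @[w --> v] --> c v.
    apply: (@continuous_comp _ _ _ set_val (fun u : 'rV[R]_2 => u 0 ord_max)).
      exact: initial_continuous.
    exact: coord_continuous.
  have ht : c w * t @[w --> v] --> c v * t by apply: cvgM hv _; exact: cvg_cst.
  apply: (@cvg_pair _ _ _ (nbhs v) (nbhs x) (nbhs (c v * t)) fv _ _
    (fun=> x) (fun w => c w * t) _ ht).
  exact: cvg_cst.
exact: flow_continuous.
Qed.

HB.instance Definition _ := isContinuous.Build (simplex R 1) X trajectory_map
  trajectory_map_continuous.

Definition trajectory : singular R X 1 := trajectory_map.

End Trajectory.

(* Index convention for chains: points y 0, ..., y N and times t 1, ..., t N;
   other values of y and t are irrelevant. *)
Section Dynamics.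
Variables (R : realType) (X : metricType R).
Variables (xi : cohomology1 R X) (Phi : flow R X).

Definition joins (s : singular R X 1) (B : set X) (x y : X) :=
  [/\ source s = x, target s = y & range s `<=` B].

(* c is required to be a cycle; it need not be a single singular simplex. *)
Definition represents (z : homology1 R X int) (c : chain R X int 1) :=
  exists2 c' : cycle1 R X int, lkval c' = c & z = \pi_(homology1 R X int) c'.

Definition is_chain (delta T : R) (N : nat) (x : nat -> X) (t : nat -> R) :=
  (0 < N)%N /\ forall i, (i < N)%N ->
    T <= t i.+1 /\ mdist (Phi (x i, t i.+1)) (x i.+1) < delta.

Definition closed_chain delta T N (x : nat -> X) t :=
  is_chain delta T N x t /\ x 0%N = x N.

Definition is_cycle delta T (x : X) (t : R) :=
  T <= t /\ mdist x (Phi (x, t)) < delta.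

Definition chain_recurrent : set X := [set x | forall delta T, 0 < delta ->
  1 <= T -> exists N y t, closed_chain delta T N y t /\ y 0%N = x].

Definition is_scale (eps delta0 : R) :=
  [/\ 0 < eps, 0 < delta0,
      forall x, cech_restriction_eq0 xi (ball x (2 * eps)) &
      forall x y, mdist x y < delta0 ->
        exists w s, joins s (ball w eps) x y].

(* The concatenation of paths is the sum of the corresponding singular
   1-simplices. *)
Definition associated (eps : R) N (x : nat -> X) (t : nat -> R)
    (z : homology1 R X int) :=
  exists sigma : nat -> singular R X 1,
    (forall i, (i < N)%N -> exists w,
      joins (sigma i.+1) (ball w eps) (Phi (x i, t i.+1)) (x i.+1)) /\
    represents z (\sum_(i < N)
      (<< trajectory Phi (x i) (t i.+1) >> + << sigma i.+1 >>)).

Definition R_xi (eps delta0 : R) : set X := [set x | forall delta T,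
  0 < delta < delta0 -> 1 < T ->
  exists N y t, [/\ closed_chain delta T N y t, y 0%N = x &
    forall z, associated eps N y t z -> pairing xi z = 0]].

Definition isolated_in (A B : set X) :=
  exists2 U, open U /\ A `<=` U & U `&` B = A.

Definition C_xi eps delta0 : set X := chain_recurrent `\` R_xi eps delta0.

(* A cycle (x, t) is the closed chain x_0 = x_1 = x, t_1 = t. *)
Definition condition_B eps delta0 := exists delta T,
  [/\ 0 < delta, 1 < T & forall x t z, is_cycle delta T x t ->
    C_xi eps delta0 x ->
    associated eps 1 (fun=> x) (fun=> t) z -> pairing xi z <= -1].

Definition closing_sequence (x : X) (xs : nat -> X) (ts : nat -> R) :=
  [/\ forall n, 1 < ts n, xs n @[n --> \oo] --> x &
      Phi (xs n, ts n) @[n --> \oo] --> x].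

(* "Short" return paths: they shrink to the base point x.  This determines z n
   for n large. *)
Definition closing_classes (x : X) (xs : nat -> X) (ts : nat -> R)
    (z : nat -> homology1 R X int) :=
  forall e, 0 < e -> \forall n \near \oo, exists s : singular R X 1,
    joins s (ball x e) (Phi (xs n, ts n)) (xs n) /\
    represents (z n) (<< trajectory Phi (xs n) (ts n) >> + << s >>).

Definition D_X := ray (homology1 R X R).

Definition direction (z : homology1 R X int) : D_X := \pi_D_X (extend_class R z).

Definition homology_direction (nrm : homology1 R X R -> R) x xs ts (d : D_X) :=
  exists (z : nat -> homology1 R X int) (k : nat -> nat),
    [/\ closing_classes x xs ts z, {homo k : m n / (m < n)%N} &
      cvg_ray nrm (fun n => direction (z (k n))) d].

Definition fried_condition nrm eps delta0 :=
  forall x xs ts d, closing_sequence x xs ts ->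
    (forall n, C_xi eps delta0 (xs n)) ->
    homology_direction nrm x xs ts d -> pairing xi (repr d) < 0.

End Dynamics.

(* Main.v *)
From HB Require Import structures.
From mathcomp Require Import all_boot all_order all_algebra.
From mathcomp Require Import generic_quotient ring_quotient freeg.
From mathcomp Require Import all_classical reals topology normedtype.
From mathcomp Require Import ring lra zify.
Require Import Defs.

(** Fix a cocycle c in the class xi.  The polyhedron has arbitrarily small star
    neighbourhoods, so a finite net of points cuts every path into short steps,
    each homologous, up to a potential b at its ends, to one of finitely many
    cycles.  Hence H_1(X; R) is finite dimensional, the class of a closed orbit
    piece of length t has norm O(t), and the drift b(x) + c(x -> x.t) - b(x.t)
    is additive in t and bounded for bounded t.

    (B) says that the drift is at most -1 whenever an orbit of C_xi returns to
    the same cell after a long time.  Deleting the pieces between the first and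
    last visits to a cell bounds the drift above, and the pigeonhole principle
    applied to the cells makes it at most A - a t with a > 0.  Dividing by the
    norm of the class gives a negative bound on limit directions; when t stays
    bounded, one passes to a multiple of the loop, which is again almost
    closed.  Conversely, if (B) fails, compactness of X and of the unit sphere
    of H_1(X; R) gives a closing sequence in C_xi whose direction pairs
    nonnegatively with xi. *)

Set Implicit Arguments.
Unset Strict Implicit.
Unset Printing Implicit Defensive.

Import Order.TTheory GRing.Theory Num.Theory.
Import numFieldNormedType.Exports.

Local Open Scope classical_set_scope.
Local Open Scope ring_scope.
Local Open Scope quotient_scope.

(** * Singular simplices cut out of maps of the plane, and null-homologous chains *)

Section AffineSimplices.
Variables (R : realType) (X : topologicalType).
Implicit Types (H : R * R -> X).

(** The potential [b] takes values in chains rather than in numbers. One relation between chains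
    then serves three purposes: evaluated by xi it controls the drift, mapped to real homology it
    gives a finite spanning set, and counted by its number of steps it bounds the norm of a class by
    time. The correction by [b] is also what makes bounds possible: an arbitrary singular cocycle
    may be unbounded on short paths, whereas the corrected one takes on them only finitely many
    values, one for each pair of cells.

    Integrality enters three times. A return to the same cell costs no error term, so each such
    return lowers the drift by at least 1 and returns can be counted against time. For a loop of
    bounded time only a multiple is seen to be negative; the value itself is then negative, hence at
    most -1. In the converse, a value that is not at most -1 is at least 0, a condition that
    survives limits. Invariance of C_xi under the flow is what allows (B) to be applied at
    intermediate points of an orbit. *)

Definition singular_of n (f : simplex R n -> X) (cf : continuous f) :
  singular R X n := HB.pack f (isContinuous.Build _ _ f cf).

Lemma singularP n (s s' : singular R X n) : (forall v, s v = s' v) -> s = s'.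
Proof. by move=> h; apply/continuousEP. Qed.

Definition affine_point n (p : 'I_n.+1 -> R * R) (v : simplex R n) : R * R :=
  (\sum_i (p i).1 * val v 0 i, \sum_i (p i).2 * val v 0 i).

Lemma continuous_coord n (i : 'I_n.+1) :
  continuous (fun v : simplex R n => val v 0 i).
Proof.
move=> v; apply: (@continuous_comp _ _ _ set_val (fun u : 'rV[R]_n.+1 => u 0 i)).
  exact: initial_continuous.
exact: coord_continuous.
Qed.

Lemma continuous_weighted_sum n (a : 'I_n.+1 -> R) :
  continuous (fun v : simplex R n => \sum_i a i * val v 0 i).
Proof.
have cD : continuous (fun x : R * R => x.1 + x.2) by exact: add_continuous.
apply: (continuous_big cD) => i _ v.
have Fv : Filter (nbhs v) := nbhs_filter v.
pose c (w : simplex R n) : R := val w 0 i.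
have hv : c w @[w --> v] --> c v by exact: continuous_coord.
by apply: cvgM _ hv; exact: cvg_cst.
Qed.

Lemma continuous_affine_point n (p : 'I_n.+1 -> R * R) :
  continuous (affine_point p).
Proof.
move=> v; have Fv : Filter (nbhs v) := nbhs_filter v.
pose c k (w : simplex R n) : R := \sum_i k (p i) * val w 0 i.
have hc k : c k w @[w --> v] --> c k v.
  by have := @continuous_weighted_sum n (k \o p) v.
exact: (cvg_pair (hc fst) (hc snd)).
Qed.

(** Elementary homologies come from a continuous map [H] of the whole plane. Faces of an affine
    simplex are again affine, so a single triangle supplies all of them. *)
Definition affine_singular n H (cH : continuous H) (p : 'I_n.+1 -> R * R) :
  singular R X n.
Proof.
apply: (@singular_of n (H \o affine_point p)).
by move=> v; apply: continuous_comp; [exact: continuous_affine_point|exact: cH].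
Defined.

Lemma face_affine n H (cH : continuous H) (p : 'I_n.+2 -> R * R) i :
  face i (affine_singular cH p) = affine_singular cH (p \o fintype.lift i).
Proof.
apply: singularP => v; rewrite /= /affine_point; congr (H (_, _)).
all: rewrite (bigD1_ord i) //= mxE unlift_none mulr0 add0r.
all: by apply: eq_bigr => k _; rewrite mxE liftK.
Qed.

Definition points2 (p q : R * R) (i : 'I_2) := nth 0 [:: p; q] i.
Definition points3 (p q r : R * R) (i : 'I_3) := nth 0 [:: p; q; r] i.

Definition segment H (cH : continuous H) (p q : R * R) : singular R X 1 :=
  affine_singular cH (points2 p q).

Definition null_homologous (z : chain R X int 1) :=
  exists w : chain R X int 2, boundary w = z.

Local Notation bdry := null_homologous.

Lemma bdryD z z' : bdry z -> bdry z' -> bdry (z + z').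
Proof. by move=> [w <-] [w' <-]; exists (w + w'); rewrite linearD. Qed.

Lemma bdryN z : bdry z -> bdry (- z).
Proof. by move=> [w <-]; exists (- w); rewrite linearN. Qed.

Lemma bdryB z z' : bdry z -> bdry z' -> bdry (z - z').
Proof. by move=> bz bz'; apply: bdryD => //; apply: bdryN. Qed.

Lemma segment_triangle H (cH : continuous H) p q r :
  bdry (<< segment cH q r >> - << segment cH p r >> + << segment cH p q >>).
Proof.
exists << affine_singular cH (points3 p q r) >>.
rewrite boundaryU scale1r /boundary_simplex !big_ord_recl big_ord0 /= addr0.
rewrite !face_affine expr0 /bump /= !expr1 expr2 mulN1r opprK.
rewrite addrA.
suff [-> -> ->] : [/\ points3 p q r \o fintype.lift ord0 = points2 q r,
    points3 p q r \o fintype.lift (fintype.lift ord0 ord0) = points2 p r &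
    points3 p q r \o fintype.lift (fintype.lift ord0 (fintype.lift ord0 ord0)) = points2 p q].
  by rewrite -freegUN.
by split; apply/funext => -[[|[|//]] i2].
Qed.

(** When the three vertices coincide, two of the three sides of the triangle cancel. *)
Lemma segment_degenerate H (cH : continuous H) p : bdry << segment cH p p >>.
Proof.
by have := segment_triangle cH p p p; rewrite subrr add0r.
Qed.

(** Two triangles share the diagonal from [p] to [r], which cancels. *)
Lemma segment_square H (cH : continuous H) p q r s :
  bdry (<< segment cH p q >> + << segment cH q r >>
        - << segment cH p s >> - << segment cH s r >>).
Proof.
have := bdryB (segment_triangle cH p q r) (segment_triangle cH p s r).
by congr bdry; apply/eqP/freeg_eqP => k; rewrite !(coeffB, coeffD); ring.
Qed.

Definition param (v : simplex R 1) : R := val v 0 ord_max.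

Lemma param_bound (v : simplex R 1) : 0 <= param v <= 1.
Proof.
have [v0 v1] := set_mem (valP v); rewrite v0 -v1 /=.
by rewrite big_ord_recr /= lerDr big_ord_recl big_ord0 addr0.
Qed.

Lemma paramC (v : simplex R 1) : val v 0 ord0 = 1 - param v.
Proof.
have [_ <-] := set_mem (valP v); rewrite big_ord_recr big_ord_recl big_ord0 /=.
by rewrite addr0; apply/esym; rewrite (_ : widen_ord _ _ = ord0) ?addrK //; apply/val_inj.
Qed.

Lemma segmentE H (cH : continuous H) p q v : segment cH p q v =
  H (p.1 + (q.1 - p.1) * param v, p.2 + (q.2 - p.2) * param v).
Proof.
rewrite /segment /= /affine_point !big_ord_recl !big_ord0 /=.
rewrite (_ : fintype.lift ord0 ord0 = ord_max); last exact/val_inj.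
by rewrite paramC /points2 /= -/(param v); congr (H (_, _)); ring.
Qed.

Lemma param_source : param (vertex R ord0) = 0.
Proof. by rewrite /param mxE. Qed.

Lemma param_target : param (vertex R ord_max) = 1.
Proof. by rewrite /param mxE !eqxx. Qed.

(** A retraction of the line onto [0, 1]: it extends a path from the simplex to the line, and so
    makes it available to maps of the plane. *)
Definition clamp01 (r : R) : R := Num.max 0 (Num.min 1 r).

Lemma clamp01_bound r : 0 <= clamp01 r <= 1.
Proof. by rewrite le_max lexx /= ge_max ler01 ge_min lexx. Qed.

Lemma clamp01_id r : 0 <= r <= 1 -> clamp01 r = r.
Proof. by move=> /andP[r0 r1]; rewrite /clamp01 min_r // max_r. Qed.

Lemma continuous_clamp01 : continuous clamp01.
Proof.
move=> r; apply: (continuous_max (cvg_cst _)).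
exact: (continuous_min (cvg_cst _) cvg_id).
Qed.

Lemma clamp_simplex_subproof r :
  \row_(j < 2) (if j == ord0 then 1 - clamp01 r else clamp01 r) \in simplex R 1.
Proof.
have /andP[c0 c1] := clamp01_bound r.
apply/mem_set; split=> [j|]; first by rewrite mxE; case: ifP; rewrite ?subr_ge0.
by rewrite !big_ord_recl big_ord0 !mxE /= addr0 subrK.
Qed.

Definition clamp_simplex r : simplex R 1 := SigSub (clamp_simplex_subproof r).

Lemma param_clamp r : param (clamp_simplex r) = clamp01 r.
Proof. by rewrite /param mxE. Qed.

Lemma simplex1P (v w : simplex R 1) : param v = param w -> v = w.
Proof.
move=> vw; apply/val_inj/rowP => j; have [->|j0] := eqVneq j ord0.
  by rewrite !paramC vw.
by rewrite (_ : j = ord_max) //; apply/val_inj; case: j j0 => -[|[]].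
Qed.

Lemma clamp_paramK v : clamp_simplex (param v) = v.
Proof. by apply: simplex1P; rewrite param_clamp clamp01_id ?param_bound. Qed.

Lemma continuous_clamp_simplex : continuous clamp_simplex.
Proof.
apply: (@continuous_comp_initial _ _ _ set_val) => r S /= /nbhs_ballP[e e0 eS].
have /cvgrPdist_lt/(_ e e0) ce := @continuous_clamp01 r.
apply: filterS ce => r' rr'; apply: eS; split=> // k j; rewrite ord1 !mxE.
case: ifP => _ //; rewrite /ball /= opprB addrAC addrA [1 + _]addrC addrK.
by rewrite distrC.
Qed.

Definition path_map (s : singular R X 1) (r : R) : X := s (clamp_simplex r).

Lemma continuous_path_map s : continuous (path_map s).
Proof.
move=> r; apply: continuous_comp; first exact: continuous_clamp_simplex.
exact: cts_fun.
Qed.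

Lemma path_map_param s v : path_map s (param v) = s v.
Proof. by rewrite /path_map clamp_paramK. Qed.

Lemma path_map0 s : path_map s 0 = source s.
Proof. by rewrite -param_source path_map_param. Qed.

Lemma path_map1 s : path_map s 1 = target s.
Proof. by rewrite -param_target path_map_param. Qed.

Lemma path_map_range (s : singular R X 1) r : range s (path_map s r).
Proof. by exists (clamp_simplex r). Qed.

Lemma continuous_path_map_fst s : continuous (fun q : R * R => path_map s q.1).
Proof.
move=> q; apply: (@continuous_comp _ _ _ fst (path_map s)); first exact: cvg_fst.
exact: continuous_path_map.
Qed.

(** The path is read as a map of the plane that ignores the second coordinate; subdividing a path is
    then an instance of [segment_triangle]. *)
Definition subpath s a c := segment (@continuous_path_map_fst s) (a, 0) (c, 0).

Lemma subpathE s a c v : subpath s a c v = path_map s (a + (c - a) * param v).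
Proof. by rewrite /subpath segmentE. Qed.

Lemma subpath01 s : subpath s 0 1 = s.
Proof.
by apply: singularP => v; rewrite subpathE subr0 mul1r add0r path_map_param.
Qed.

Lemma subpath_source s a c : source (subpath s a c) = path_map s a.
Proof. by rewrite /source subpathE param_source mulr0 addr0. Qed.

Lemma subpath_target s a c : target (subpath s a c) = path_map s c.
Proof. by rewrite /target subpathE param_target mulr1 addrC subrK. Qed.

Lemma subpath_between s a c v : a <= c -> exists2 u, a <= u <= c &
  subpath s a c v = path_map s u.
Proof.
move=> ac; exists (a + (c - a) * param v); last exact: subpathE.
have /andP[v0 v1] := param_bound v; apply/andP; split.
  by rewrite lerDl mulr_ge0 ?subr_ge0.
by rewrite -lerBrDl; apply: ler_piMr => //; rewrite subr_ge0.
Qed.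

Definition point (x : X) : singular R X 0 := @singular_of 0 (cst x) (@cst_continuous _ _ x).

Lemma boundary1U (A : nzRingType) (a : A) (s : singular R X 1) :
  boundary << a *g s >> = << a *g point (target s) >> - << a *g point (source s) >>.
Proof.
rewrite boundaryU /boundary_simplex !big_ord_recl big_ord0 /= addr0.
rewrite expr0 /bump /= expr1 scalerDr !scale_freegU mulr1 mulrN1 freegUN.
have f0 : face ord0 s = point (target s).
  apply: singularP => v; congr (s _); apply: simplex1P.
  rewrite param_target /param mxE.
  rewrite (_ : ord_max = fintype.lift ord0 ord0) ?liftK; last exact/val_inj.
  by have [_ <-] := set_mem (valP v); rewrite big_ord_recl big_ord0 addr0.
have f1 : face (fintype.lift ord0 ord0) s = point (source s).
  apply: singularP => v; congr (s _); apply: simplex1P.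
  rewrite param_source /param mxE (_ : ord_max = fintype.lift ord0 ord0).
    by rewrite unlift_none.
  exact/val_inj.
by rewrite f0 f1 -freegUN.
Qed.

End AffineSimplices.

(** * Homologically trivial sets *)

Section LocallyTrivial.
Variables (R : realType) (X : metricType R).
Local Notation bdry := (@null_homologous R X).

(** [p y] plays the role of a path from a centre to [y], so paths in [U] with the same ends are
    homologous in [X]. The bounding 2-chains may leave [U]. *)
Definition homologically_trivial (U : set X) :=
  exists p : X -> chain R X int 1, forall s : singular R X 1, range s `<=` U ->
    bdry (<< s >> - p (target s) + p (source s)).

Definition star_neighborhoods := forall (x : X) (e : R), 0 < e ->
  exists U : set X, [/\ open U, U x, U `<=` ball x e, homologically_trivial U &
    forall y y', U y -> U y' -> exists s, joins s U y y'].

Lemma homologically_trivialS (U V : set X) :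
  U `<=` V -> homologically_trivial V -> homologically_trivial U.
Proof.
by move=> UV [p hp]; exists p => s sU; apply: hp; apply: subset_trans UV.
Qed.

Lemma null_homologous_cst (s : singular R X 1) x : (forall v, s v = x) -> bdry << s >>.
Proof.
move=> sx; have := @segment_degenerate R X _ (@cst_continuous (R * R)%type X x) 0.
by congr (bdry << _ >>); apply: singularP => v; rewrite segmentE sx.
Qed.

(** For a path [s] the square [k l (s u)] has as sides [s], a constant path and the two rays to the
    ends of [s]. Continuity is asked only along maps into [U], because in the application [k]
    involves default values elsewhere. *)
Lemma contraction_trivial (U : set X) (x : X) (k : R -> X -> X) :
  (forall y, U y -> k 0 y = x) -> (forall y, U y -> k 1 y = y) ->
  (forall (l : R * R -> R) (u : R * R -> X), continuous l -> continuous u ->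
    (forall q, 0 <= l q <= 1) -> (forall q, U (u q)) ->
    continuous (fun q => k (l q) (u q))) ->
  homologically_trivial U.
Proof.
move=> k0 k1 kc.
pose is_ray y (z : chain R X int 1) := exists2 s : singular R X 1,
  (forall v, s v = k (param v) y) & z = << s >>.
(* A chain satisfying [is_ray y] is unique; [xget] returns 0 where there is no continuous ray. *)
exists (fun y => xget 0 (is_ray y)) => s sU.
have cl : continuous (fun q : R * R => clamp01 q.1).
  move=> q; apply: (@continuous_comp _ _ _ fst (@clamp01 R)); first exact: cvg_fst.
  exact: continuous_clamp01.
have cs : continuous (fun q : R * R => path_map s q.2).
  move=> q; apply: (@continuous_comp _ _ _ snd (path_map s)); first exact: cvg_snd.
  exact: continuous_path_map.
have sU' (q : R * R) : U (path_map s q.2) by apply/sU/path_map_range.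
have cH := kc _ _ cl cs (fun q => clamp01_bound q.1) sU'.
have ray b : 0 <= b <= 1 -> xget 0 (is_ray (path_map s b)) =
    << segment cH (0, b) (1, b) >>.
  move=> b01; have rayb : is_ray (path_map s b) << segment cH (0, b) (1, b) >>.
    exists (segment cH (0, b) (1, b)) => // v; rewrite segmentE /=.
    by rewrite subr0 mul1r add0r subrr mul0r addr0 clamp01_id ?param_bound.
  have [s' s'E ->] := xgetPex 0 (ex_intro _ _ rayb); have [s'' s''E ->] := rayb.
  by congr << _ >>; apply: singularP => v; rewrite s'E s''E.
rewrite -path_map0 -path_map1 !ray ?lexx ?ler01 //.
have Hs : segment cH (1, 0) (1, 1) = s.
  apply: singularP => v; rewrite segmentE /= subrr mul0r addr0 subr0 mul1r add0r.
  by rewrite clamp01_id ?ler01 ?lexx // k1 ?path_map_param //; apply: sU; exists v.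
have Hx : bdry << segment cH (0, 0) (0, 1) >>.
  apply: (@null_homologous_cst (segment cH (0, 0) (0, 1)) x) => v.
  rewrite segmentE /= subrr mul0r addr0 subr0 mul1r add0r.
  by rewrite clamp01_id ?ler01 ?lexx // k0 // path_map_param; apply: sU; exists v.
have := bdryD (segment_square cH (0, 0) (1, 0) (1, 1) (0, 1)) Hx.
rewrite Hs; congr bdry.
by apply/eqP/freeg_eqP => j; rewrite !(coeffB, coeffD); ring.
Qed.

End LocallyTrivial.

(** * Stars and compactness of the realization of a complex *)

Section StarNeighborhood.
Variables (R : realType) (m : nat) (K : {set {set 'I_m}}).
Implicit Types (v u : 'rV[R]_m).

Lemma support_bound v : exists2 r : R, 0 < r &
  forall i, 0 < v 0 i -> r <= v 0 i.
Proof.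
exists (\big[Num.min/1]_(i | 0 < v 0 i) v 0 i) => [|i vi].
  by elim/big_ind: _ => // x y x0 y0; rewrite lt_min x0.
by rewrite (bigD1 i) //= ge_min lexx.
Qed.

(** Near [v] the support of [u] contains that of [v]. Hence the point of the segment has the support
    of [u] when [l > 0] and that of [v] when [l = 0], and the segment stays in the complex. *)
Lemma star_realization v u r (l : R) : realization K v -> realization K u ->
  (forall i, 0 < v 0 i -> r <= v 0 i) -> ball v r u -> 0 <= l <= 1 ->
  realization K (v + l *: (u - v)) /\ ball v r (v + l *: (u - v)).
Proof.
move=> [v0 v1 vK] [u0 u1 uK] rv [r0 vu] /andP[l0 l1].
have coordE i : (v + l *: (u - v)) 0 i = (1 - l) * v 0 i + l * u 0 i.
  by rewrite !mxE; ring.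
split; last first.
  split=> // k i; rewrite ord1; have := vu 0 i; rewrite /ball /= coordE => vui.
  rewrite (_ : _ - _ = l * (v 0 i - u 0 i)); last by ring.
  by rewrite normrM ger0_norm // (le_lt_trans _ vui) // ler_piMl.
have suppu i : v 0 i != 0 -> 0 < u 0 i.
  move=> vi; have vi0 : 0 < v 0 i by rewrite lt_neqAle eq_sym vi v0.
  have := vu 0 i; rewrite /ball /= ltr_distlC => /andP[h _].
  by rewrite (le_lt_trans _ h) // subr_ge0 rv.
split=> [i||].
- by rewrite coordE addr_ge0 // mulr_ge0 // ?subr_ge0.
- under eq_bigr do rewrite coordE.
  by rewrite big_split /= -!mulr_sumr v1 u1 !mulr1 subrK.
- have [l00|l00] := eqVneq l 0.
    rewrite (_ : finset _ = finset (fun i => v 0 i != 0)) //.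
    by apply/setP => i; rewrite !inE coordE l00 subr0 mul0r mul1r addr0.
  rewrite (_ : finset _ = finset (fun i => u 0 i != 0)) //.
  apply/setP => i; rewrite !inE coordE.
  have [vi|/suppu ui] := eqVneq (v 0 i) 0.
    by rewrite vi mulr0 add0r mulf_eq0 (negPf l00).
  have lp : 0 < l by rewrite lt_neqAle eq_sym l00.
  by rewrite !gt_eqF // ltr_wpDl ?mulr_gt0 ?mulr_ge0 ?subr_ge0.
Qed.

Lemma continuous_row_sum (P : pred 'I_m) (c : 'I_m -> R) :
  continuous (fun v : 'rV[R]_m => \sum_(i | P i) c i * v 0 i).
Proof.
have cD : continuous (fun x : R * R => x.1 + x.2) by exact: add_continuous.
apply: (continuous_big cD) => i _ v.
have ci : {for v, continuous (fun u : 'rV[R]_m => u 0 i)} by exact: coord_continuous.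
exact: cvgMl_tmp ci.
Qed.

(* The support condition is the vanishing of a product of sums over the simplices. *)
Lemma realization_compact :
  (forall S T : {set 'I_m}, S \in K -> T \subset S -> (0 < #|T|)%N -> T \in K) ->
  compact (realization (R := R) K).
Proof.
move=> Kdown; apply: bounded_closed_compact.
  exists 1; split=> // M M1 v [v0 v1 _]; apply: ltW; apply: le_lt_trans M1.
  rewrite [leLHS](mx_normrE v); apply/bigmax_leP; split=> // -[i j] _ /=.
  rewrite ord1 ger0_norm // -v1 (bigD1 j) //= lerDl sumr_ge0 //.
pose p (v : 'rV[R]_m) := \prod_(S in K) \sum_(i | i \notin S) 1 * v 0 i.
have -> : realization (R := R) K = (\bigcap_(i in [set: 'I_m]) [set v : 'rV[R]_m | 0 <= v 0 i])
    `&` [set v : 'rV[R]_m | \sum_i 1 * v 0 i = 1] `&` [set v | p v = 0].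
  apply/seteqP; split=> v.
    move=> [v0 v1 vK]; split; [split=> [i _|]|] => //=.
      by under eq_bigr do rewrite mul1r.
    apply/eqP/prodf_eq0; exists (finset (fun i => v 0 i != 0)) => //.
    by rewrite big1 // => i; rewrite inE negbK mul1r => /eqP.
  move=> [[v0 v1] /eqP /prodf_eq0[S SK S0]].
  have {}v0 i : 0 <= v 0 i by exact: v0.
  have {}v1 : \sum_i v 0 i = 1.
    by rewrite -[RHS]v1; apply: eq_bigr => i _; rewrite mul1r.
  split=> //; apply: Kdown SK _ _.
    apply/fintype.subsetP => i; rewrite inE; apply: contraR => iS.
    move: S0; rewrite psumr_eq0 => [/allP/(_ i)|j _]; last by rewrite mul1r.
    by rewrite mem_index_enum iS mul1r => /(_ isT).
  rewrite card_gt0; apply/negP => /eqP s0; move: v1; rewrite big1 => [/esym/eqP|i _].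
    by rewrite oner_eq0.
  by apply/eqP; move/setP/(_ i): s0; rewrite !inE => /negbT; rewrite negbK.
apply: closedI; first apply: closedI.
- apply: closed_bigI => i _; apply: (preimage_closed _ (@closed_ge R 0)) => v _.
  exact: coord_continuous.
- apply: (preimage_closed _ (@closed_eq R 1)) => v _; exact: continuous_row_sum.
- apply: (preimage_closed _ (@closed_eq R 0)) => v _.
  have cM : continuous (fun x : R * R => x.1 * x.2) by exact: mul_continuous.
  by apply: (continuous_big cM) => S _; exact: continuous_row_sum.
Qed.

End StarNeighborhood.

(** * Compactness and local structure of the polyhedron *)

Section Polyhedron.
Variables (R : realType) (X : metricType R).
Hypothesis hX : finite_polyhedron R X.

Lemma polyhedron_compact : compact [set: X].
Proof.
have [m [K [f [g [[_ Kdown] cf cg fK gK]]]]] := hX.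
(* [insubd] needs a default point, so the empty space is treated apart. *)
have [[x0 _]|X0] := pselect (exists x : X, True); last first.
  rewrite (_ : [set: X] = set0); first exact: compact0.
  by rewrite -subset0 => x _; apply: X0; exists x.
pose G u := g (insubd (f x0) u).
have -> : [set: X] = G @` realization K.
  apply/esym; rewrite -subTset => x _; exists (val (f x)); first exact: set_mem (valP (f x)).
  by rewrite /G valKd fK.
apply: continuous_compact (realization_compact Kdown).
apply/subspace_sigL_continuousP.
rewrite (_ : sigL _ _ = g) //; apply/funext => u.
by rewrite /G /sigL /= valKd.
Qed.

Lemma polyhedron_star : star_neighborhoods X.
Proof.
move=> x e e0; have [m [K [f [g [hK cf cg fK gK]]]]] := hX.
have rK y : realization K (val (f y)) by exact: set_mem (valP (f y)).
pose v := val (f x).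
have [r1 r10 r1P] : exists2 r : R, 0 < r & forall w : realization K,
    ball v r (val w) -> ball x e (g w).
  have : nbhs (f x) (g @^-1` ball x e).
    by apply: cg; rewrite fK; exact: nbhsx_ballx.
  move=> [_ [[W oW <-] Wv WE]].
  have /nbhs_ballP[r r0 rW] := open_nbhs_nbhs (conj oW Wv).
  by exists r => // w vw; apply: WE; exact: rW.
have [r2 r20 r2P] := support_bound v.
pose r := Num.min r1 r2.
have r0 : 0 < r by rewrite lt_min r10.
have rP i : 0 < v 0 i -> r <= v 0 i.
  by move=> vi; rewrite ge_min r2P ?orbT.
pose U := [set y | ball v r (val (f y))].
have starU y l : U y -> 0 <= l <= 1 -> let u := v + l *: (val (f y) - v) in
    realization K u /\ ball v r u.
  by move=> Uy l01; exact: (star_realization (rK x) (rK y) rP Uy l01).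
pose h u := g (insubd (f x) u).
have ch (phi : R * R -> 'rV[R]_m) : continuous phi ->
    (forall q, realization K (phi q)) -> continuous (h \o phi).
  move=> cphi phiK; pose k (q : R * R) : realization K := insubd (f x) (phi q).
  have ck : continuous k.
    apply: (@continuous_comp_initial _ _ _ set_val).
    rewrite (_ : _ \o _ = phi) //; apply/funext => q' /=.
    by have := val_insubd (f x) (phi q'); rewrite mem_set //.
  by move=> q; have := continuous_comp (ck q) (@cg (k q)).
have hU u : realization K u -> ball v r u -> U (h u).
  by move=> uK vu; rewrite /U /= /h gK val_insubd mem_set.
have hf y : h (val (f y)) = y by rewrite /h valKd fK.
have hv : h v = x by exact: hf.
have cvf : continuous (fun y => val (f y)).
  move=> y; apply: (@continuous_comp _ _ _ f set_val); first exact: cf.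
  exact: initial_continuous.
exists U; split.
- have -> : U = (fun y => val (f y)) @^-1` (ball v r) by [].
  by apply: open_comp => [y _|]; [exact: cvf|exact: ball_open].
- exact: ballxx.
- move=> y Uy; rewrite -[y]fK; apply: r1P; apply: le_ball Uy.
  by rewrite ge_min lexx.
- apply: (@contraction_trivial _ _ U x (fun l y => h (v + l *: (val (f y) - v)))).
  + by move=> y _; rewrite scale0r addr0.
  + by move=> y _; rewrite scale1r addrC subrK.
  + move=> l u cl cu l01 Uu.
    apply: (ch (fun q => v + l q *: (val (f (u q)) - v))).
      move=> q; apply: cvgD; first exact: cvg_cst.
      apply: cvgZ; first exact: cl.
      apply: cvgB; last exact: cvg_cst.
      by apply: (@continuous_comp _ _ _ u (fun y => val (f y))); [exact: cu|exact: cvf].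
    by move=> q; have [] := starU _ _ (Uu q) (l01 q).
- move=> y y' Uy Uy'.
  (* A path through the centre of the star: at each parameter at least one of the two clamped
     coefficients is 0, so the path runs along two radii. *)
  pose phi (q : R * R) := v + clamp01 (1 - 2 * q.1) *: (val (f y) - v)
    + clamp01 (2 * q.1 - 1) *: (val (f y') - v).
  have phiK q : realization K (phi q) /\ ball v r (phi q).
    rewrite /phi; have [q12|q12] := lerP (2 * q.1) 1.
      rewrite [clamp01 (2 * _ - 1)]max_l ?scale0r ?addr0; last first.
        by rewrite ge_min subr_le0 q12 orbT.
      exact: starU (clamp01_bound _).
    rewrite [clamp01 (1 - _)]max_l ?scale0r ?addr0; last first.
      by rewrite ge_min subr_le0 (ltW q12) orbT.
    exact: starU (clamp01_bound _).
  have cc (k : R -> R) : continuous k -> continuous (fun q : R * R => clamp01 (k q.1)).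
    move=> ck q; apply: (@continuous_comp _ _ _ (fun q => k q.1) (@clamp01 R)).
      by apply: (@continuous_comp _ _ _ fst k); [exact: cvg_fst|exact: ck].
    exact: continuous_clamp01.
  have cphi : continuous phi.
    have c1 : continuous (fun q : R * R => clamp01 (1 - 2 * q.1)).
      apply: (cc (fun r => 1 - 2 * r)) => t; apply: cvgB; first exact: cvg_cst.
      exact: cvgMl_tmp cvg_id.
    have c2 : continuous (fun q : R * R => clamp01 (2 * q.1 - 1)).
      apply: (cc (fun r => 2 * r - 1)) => t; apply: cvgB; last exact: cvg_cst.
      exact: cvgMl_tmp cvg_id.
    move=> q; exact: (cvgD (cvgD (cvg_cst v) (cvgZr_tmp (c1 q))) (cvgZr_tmp (c2 q))).
  have cH := ch _ cphi (fun q => (phiK q).1).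
  exists (segment cH (0, 0) (1, 0)); split.
  + rewrite /source segmentE param_source /= mulr0 addr0 /phi /=.
    rewrite mulr0 subr0 sub0r clamp01_id ?ler01 ?lexx // [clamp01 (-1)]max_l; last first.
      by rewrite ge_min lerN10 orbT.
    by rewrite scale0r addr0 scale1r addrC subrK hf.
  + have c1 : clamp01 (1 - 2 * (0 + (1 - 0) * 1)) = 0 :> R.
      by rewrite /clamp01 max_l // ge_min; apply/orP; right; lra.
    have c2 : clamp01 (2 * (0 + (1 - 0) * 1) - 1) = 1 :> R.
      by rewrite clamp01_id; lra.
    rewrite /target segmentE param_target /phi /= c1 c2.
    by rewrite scale0r addr0 scale1r addrC subrK hf.
  + by move=> _ [w _ <-]; rewrite segmentE; exact: (hU _ (phiK _).1 (phiK _).2).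
Qed.

End Polyhedron.

(** * Uniform constants from compactness *)

Section Compactness.
Variables (R : realType) (X : metricType R).
Hypothesis cX : compact [set: X].

(** A general form of the Lebesgue number: the near-covering property is applied along [e] tending
    to 0 from the right. As [Q] need not be monotone in [e], the local hypothesis speaks of all
    small [e]. *)
Lemma uniform_radius (T : pseudoMetricType R) (A : set T) (Q : T -> R -> Prop) :
  compact A ->
  (forall x, A x -> exists2 r : R, 0 < r & forall (y : T) (e : R), A y -> ball x r y -> 0 < e < r -> Q y e) ->
  exists2 e : R, 0 < e & forall y, A y -> Q y e.
Proof.
move=> /compact_near_coveringP/near_covering_withinP cA hQ.
have := cA R (at_right (0 : R)) (fun e y => Q y e) _.
have : forall x, A x -> \forall y \near x & e \near at_right (0 : R), A y -> Q y e.
  move=> x /hQ[r r0 rQ].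
  exists (ball x r, [set e | 0 < e < r]).
    split; first exact: nbhsx_ballx.
    near=> e; rewrite /=; apply/andP; split; near: e.
      exact: nbhs_right_gt.
    exact: nbhs_right_lt.
  by move=> [y e] /= [xy e0r] Ay; apply: rQ.
move=> h /(_ _ h) AQ.
have [e [e0 eQ]] := filter_ex (filterI (nbhs_right_gt (0 : R)) AQ).
by exists e => // y Ay; exact: eQ.
Unshelve. all: by end_near.
Qed.

Lemma mdist_ball (x y : X) r : mdist x y < r = (ball x r y) :> Prop.
Proof. by rewrite ballEmdist. Qed.

Lemma ltr_dist_between (r a u c e : R) :
  `|r - a| < e -> `|r - c| < e -> a <= u <= c -> `|r - u| < e.
Proof.
rewrite !ltr_norml => /andP[ra1 ra2] /andP[rc1 rc2] /andP[au uc].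
by apply/andP; split; lra.
Qed.

(** A mesh [n.+1%:R^-1] below the Lebesgue number cuts [0, 1] into intervals covered by the local
    hypothesis, and [P] is accumulated from left to right. This is the tool for cutting an arbitrary
    path into short pieces. *)
Lemma interval_induction (P : R -> R -> Prop) :
  (forall r : R, 0 <= r <= 1 -> exists2 e : R, 0 < e & forall a c : R,
     0 <= a -> a <= c -> c <= 1 -> `|r - a| < e -> `|r - c| < e -> P a c) ->
  (forall a b c : R, a <= b -> b <= c -> P a b -> P b c -> P a c) -> P 0 1.
Proof.
move=> locP transP.
have [|e e0 eP] := @uniform_radius R `[0, 1]%classic
    (fun a e => forall c, a <= c -> c < a + e -> c <= 1 -> P a c) (@segment_compact R 0 1).
  move=> r /= /[!in_itv] /= /locP[e e0 eP]; exists (e / 2); first by rewrite divr_gt0.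
  move=> a d /[!in_itv] /= /andP[a0 a1] ra /andP[d0 de] c ac cd c1.
  have {}ra : `|r - a| < e / 2 by exact: ra.
  apply: eP => //; first by apply: lt_trans ra _; lra.
  rewrite (_ : r - c = (r - a) - (c - a)); last by ring.
  apply: le_lt_trans (ler_normB _ _) _.
  rewrite [`|c - a|]ger0_norm ?subr_ge0 //; lra.
have [n ne] : exists n : nat, n.+1%:R^-1 < e.
  have := ltr_add_invr; have [n] := @ltr_add_invr R 0 e e0; rewrite add0r.
  by exists n.
have n0 : (0 : R) < n.+1%:R by rewrite ltr0n.
suff : forall k, (k <= n.+1)%N -> P 0 (k%:R / n.+1%:R).
  by move=> /(_ n.+1 (leqnn _)); rewrite divff ?gt_eqF.
elim=> [_|k IH kn].
  rewrite mul0r; apply: eP; rewrite ?add0r //=; rewrite in_itv /= lexx ler01 //.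
have k1 : (k%:R : R) / n.+1%:R <= 1.
  by rewrite ler_pdivrMr // mul1r ler_nat ltnW.
have kk : (k.+1%:R : R) / n.+1%:R = k%:R / n.+1%:R + n.+1%:R^-1.
  by rewrite -natr1 mulrDl mul1r.
apply: (transP _ (k%:R / n.+1%:R)).
- by rewrite divr_ge0.
- by rewrite kk lerDl invr_ge0 ltW.
- by apply: IH; exact: ltnW.
- apply: eP.
  + by rewrite /= in_itv /= divr_ge0.
  + by rewrite kk lerDl invr_ge0 ltW.
  + by rewrite kk ltrD2l.
  + by rewrite ler_pdivrMr // mul1r ler_nat.
Qed.

Lemma finite_net (e : R) : 0 < e -> exists (M : nat) (w : 'I_M -> X) (i : X -> 'I_M),
  forall x, mdist (w (i x)) x < e.
Proof.
(* Finite lists filtered by inclusion: near-covering along this filter yields one finite list whose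
   balls cover [X]. *)
move=> e0; pose F := filter_from [set: seq X] (fun s => [set s' : seq X | {subset s <= s'}]).
have FF : Filter F.
  apply: filter_from_filter; first by exists [::].
  move=> s s' _ _; exists (s ++ s') => // t st; split=> x xs; apply: st.
    by rewrite mem_cat xs.
  by rewrite mem_cat xs orbT.
have [D _ /(_ D (fun _ => id)) DX] :
    \near F, [set: X] `<=` (fun y => exists2 x, x \in (F : seq X) & mdist x y < e).
  move/compact_near_coveringP : cX; apply=> // x _.
  exists (ball x e, [set s : seq X | x \in s]).
    split; first exact: nbhsx_ballx.
    by exists [:: x] => // s /(_ x); rewrite mem_head; exact.
  by move=> [y s] /= [xy xs]; exists x => //; rewrite mdist_ball.
have idx x : exists j : 'I_(size (D)), mdist (tnth (in_tuple (D)) j) x < e.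
  have [y yD yx] := DX x I.
  exists (Ordinal (etrans (index_mem y _) yD)).
  by rewrite (tnth_nth y) /= nth_index.
exists (size (D)), (tnth (in_tuple (D))).
by have [i iP] := choice idx; exists i.
Qed.

Section Uniform.
Hypothesis star : star_neighborhoods X.

Lemma uniformly_trivial : exists2 mu : R, 0 < mu &
  forall x : X, homologically_trivial (ball x mu).
Proof.
have [|mu mu0 h] := @uniform_radius X setT (fun x e => homologically_trivial (ball x e)) cX.
  move=> x _; have [U [oU Ux _ tU _]] := star x ltr01.
  have /nbhs_ballP[r r0 rU] := open_nbhs_nbhs (conj oU Ux).
  exists (r / 2) => [|y e _ xy /andP[e0 er]]; first by rewrite divr_gt0.
  apply: homologically_trivialS tU => z yz; apply: rU.
  by rewrite /= (splitr r); apply: ball_triangle xy (le_ball (ltW er) yz).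
by exists mu => // x; exact: h.
Qed.

Lemma short_paths (e : R) : 0 < e -> exists2 k : R, 0 < k &
  forall x y : X, mdist x y < k -> exists s, joins s (ball x e) x y.
Proof.
move=> e0.
have [|k k0 h] := @uniform_radius X setT
    (fun x k => forall y, mdist x y < k -> exists s, joins s (ball x e) x y) cX.
  have e20 : 0 < e / 2 by rewrite divr_gt0.
  move=> x _; have [U [oU Ux Ue _ pU]] := star x e20.
  have /nbhs_ballP[r r0 rU] := open_nbhs_nbhs (conj oU Ux).
  exists (r / 2) => [|y d _ xy /andP[d0 dr] z]; first by rewrite divr_gt0.
  rewrite mdist_ball => yz.
  have Uy : U y by apply: rU; apply: le_ball xy; rewrite ler_pdivrMr // ler_peMr ?ler1n // ltW.
  have Uz : U z by apply: rU; rewrite (splitr r); apply: ball_triangle xy (le_ball (ltW dr) yz).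
  have [s [ss st sU]] := pU _ _ Uy Uz; exists s; split=> // u /sU /Ue xu.
  by rewrite (splitr e); apply: ball_triangle xu; apply: ball_sym; exact: Ue.
by exists k => // x; exact: h.
Qed.

End Uniform.

Section Flow.
Variable Phi : flow R X.

Lemma flow_uniform (T e : R) : 0 < e -> exists2 d : R, 0 < d &
  forall x y t, `|t| <= T -> mdist x y < d -> mdist (Phi (x, t)) (Phi (y, t)) < e.
Proof.
move=> e0.
have cK := compact_setX cX (@segment_compact R (- T) T).
have [|d d0 h] := @uniform_radius (X * R)%type _
    (fun q d => forall y, mdist q.1 y < d -> mdist (Phi q) (Phi (y, q.2)) < e) cK.
  move=> q0 _; have e20 : 0 < e / 2 by rewrite divr_gt0.
  have /nbhs_ballP[r r0 rP] := @flow_continuous _ _ Phi q0 _ (nbhsx_ballx (Phi q0) _ e20).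
  exists (r / 2) => [|q d _ [q1 q2] /andP[d0 dr] y]; first by rewrite divr_gt0.
  rewrite !mdist_ball => qy.
  have rr : r / 2 <= r by rewrite ler_pdivrMr // ler_peMr ?ler1n // ltW.
  rewrite (splitr e); apply: (@ball_triangle _ _ (Phi q0)).
    by apply: ball_sym; apply: rP; split; apply: le_ball rr _ _.
  apply: rP; split; last exact: le_ball rr _ q2.
  by rewrite /= (splitr r); apply: ball_triangle q1 (le_ball (ltW dr) qy).
exists d => // x y t tT; apply: (h (x, t)); split=> //=.
by rewrite in_itv /= -ler_norml.
Qed.

Lemma flow_small_time (e : R) : 0 < e -> exists2 d : R, 0 < d &
  forall x t, `|t| <= d -> mdist x (Phi (x, t)) < e.
Proof.
move=> e0.
have [|d d0 h] := @uniform_radius X setT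
    (fun x d => forall t, `|t| <= d -> mdist x (Phi (x, t)) < e) cX.
  move=> x _; have e20 : 0 < e / 2 by rewrite divr_gt0.
  have /nbhs_ballP[r r0 rP] := @flow_continuous _ _ Phi (x, 0) _ (nbhsx_ballx (Phi (x, 0)) _ e20).
  rewrite flow0 in rP.
  exists (Num.min r (e / 2)) => [|y d _ xy /andP[d0 dr] t td]; first by rewrite lt_min r0.
  rewrite mdist_ball (splitr e); apply: (@ball_triangle _ _ x).
    by apply: ball_sym; apply: le_ball xy; rewrite ge_min lexx orbT.
  apply: rP; split=> /=; first by apply: le_ball xy; rewrite ge_min lexx.
  rewrite /ball /= sub0r normrN; apply: le_lt_trans td (lt_le_trans dr _).
  by rewrite ge_min lexx.
by exists d => // x; exact: h.
Qed.

End Flow.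

End Compactness.

(** * Chain nets, and the walks through cells that paths and orbits perform *)

Section ChainNet.
Variables (R : realType) (X : metricType R).
Local Notation bdry := (@null_homologous R X).
Local Notation C1 := (chain R X int 1).

(* [b x] is a chain from a root of the path component of [x] to [x]; a short
   path from [x] to [y] is homologous to [b y - b x] plus one of the finitely
   many cycles [g]. *)
Definition chain_net M (i : X -> 'I_M) (b : X -> C1) (g : 'I_M -> 'I_M -> cycle1 R X int)
    (mu k : R) :=
  forall s : singular R X 1, range s `<=` ball (source s) mu ->
    mdist (source s) (target s) < k ->
    bdry (b (source s) + << s >> - b (target s)
      - lkval (g (i (source s)) (i (target s)))).

Lemma boundary_joins (s : singular R X 1) U x y : joins s U x y ->
  boundary (<< s >> : C1) = << point R y >> - << point R x >>.
Proof. by case=> <- <- _; rewrite boundary1U. Qed.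

Lemma trivial_pair (U : set X) (p : X -> C1) s x y :
  (forall s : singular R X 1, range s `<=` U ->
    bdry (<< s >> - p (target s) + p (source s))) ->
  joins s U x y -> bdry (<< s >> - p y + p x).
Proof. by move=> pU [<- <-]; exact: pU. Qed.

Hypothesis cX : compact [set: X].
Hypothesis star : star_neighborhoods X.

(** [b x] runs from a root of the component to the centre of the cell of [x], and on to [x]. A short
    path and the centres of the cells of its ends form a quadrilateral inside one homologically
    trivial ball, so the path can be traded for a path between centres, and of these there are
    finitely many. *)
Lemma chain_net_exists (e : R) : 0 < e ->
  exists M (i : X -> 'I_M) b g (mu k : R), [/\ 0 < mu <= e, 0 < k <= e,
    forall x y : X, i x = i y -> mdist x y < k,
    forall x y : X, mdist x y < k -> exists s : singular R X 1, joins s (ball x mu) x y &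
    @chain_net M i b g mu k].
Proof.
move=> e0; have [mu1 mu10 triv1] := uniformly_trivial cX star.
pose mu0 := Num.min mu1 e.
have mu00 : 0 < mu0 by rewrite lt_min mu10.
have mu0e : mu0 <= e by rewrite ge_min lexx orbT.
have triv (x : X) : homologically_trivial (ball x mu0).
  by apply: (homologically_trivialS _ (triv1 x)); apply: le_ball; rewrite ge_min lexx.
have mu4 : 0 < mu0 / 4 by rewrite divr_gt0.
have [k0 k00 short] := short_paths cX star mu4.
(* Because [k <= mu0 / 4], a ball of radius [mu0 / 4] about a point within [3 * k] of [x] lies in
   the ball of radius [mu0] about [x]. *)
pose k := Num.min (Num.min k0 e) (mu0 / 4).
have kk0 : 0 < k by rewrite !lt_min k00 e0 mu4.
have kk k' : k' <= k -> [/\ k' <= k0, k' <= e & k' <= mu0 / 4].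
  by rewrite !le_min => /andP[/andP[-> ->] ->].
have [lek0 lee lemu] := kk _ (lexx k).
have k4 : 0 < k / 4 by rewrite divr_gt0.
have [M [w [i wi]]] := finite_net cX k4.
have [pth pthP] : exists pth : X -> X -> singular R X 1, forall x y,
    mdist x y < k -> joins (pth x y) (ball x (mu0 / 4)) x y.
  suff /choice[h hP] : forall q : X * X, exists s : singular R X 1,
      mdist q.1 q.2 < k -> joins s (ball q.1 (mu0 / 4)) q.1 q.2.
    by exists (fun x y => h (x, y)) => x y; exact: (hP (x, y)).
  move=> [x y] /=; have [xy|xy] := pselect (mdist x y < k); last first.
    by exists (singular_of (@cst_continuous _ _ x)).
  by have [s sP] := short _ _ (lt_le_trans xy lek0); exists s.
pose conn x y := exists z : C1, boundary z = << point R y >> - << point R x >>.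
have conn_refl x : conn x x by exists 0; rewrite linear0 subrr.
have conn_sym x y : conn x y -> conn y x.
  by move=> [z zE]; exists (- z); rewrite linearN /= zE opprB.
have conn_trans x y z : conn x y -> conn y z -> conn x z.
  move=> [s sE] [t tE]; exists (s + t); rewrite linearD /= sE tE.
  by rewrite addrC addrA subrK.
(* The root is picked by a predicate that depends only on the component. Joined centres therefore
   get the same root, which makes [gam] a cycle. *)
pose rho j := odflt j [pick l | `[< conn (w l) (w j) >]].
have rho_conn j : conn (w (rho j)) (w j).
  by rewrite /rho; case: pickP => [l /asboolP|].
have rho_eq j l : conn (w j) (w l) -> rho j = rho l.
  move=> jl; rewrite /rho (@eq_pick _ _ (fun m => `[< conn (w m) (w l) >])); last first.
    by move=> m /=; apply/asboolP/asboolP => h; apply: conn_trans h _ => //; exact: conn_sym.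
  by case: pickP => // /(_ l) /asboolP[].
have [om omE] := choice rho_conn.
pose gam j l : C1 := om j + << pth (w j) (w l) >> - om l.
have [g gE] : exists g : 'I_M -> 'I_M -> cycle1 R X int, forall j l,
    mdist (w j) (w l) < k -> lkval (g j l) = gam j l.
  suff /choice[h hP] : forall q : 'I_M * 'I_M, exists c : cycle1 R X int,
      mdist (w q.1) (w q.2) < k -> lkval c = gam q.1 q.2.
    by exists (fun j l => h (j, l)) => j l; exact: (hP (j, l)).
  (* Pairs of distant centres do not occur in a short step and receive the cycle 0. *)
  move=> [j l] /=; have [jl|jl] := pselect (mdist (w j) (w l) < k); last by exists 0.
  have bE := boundary_joins (pthP _ _ jl).
  have jlc : conn (w j) (w l) by exists << pth (w j) (w l) >>.
  have gk : gam j l \in lker_pred (@boundary R X int 0).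
    apply/eqP; rewrite /gam linearB linearD /= bE !omE (rho_eq _ _ jlc).
    by apply/eqP/freeg_eqP => q; rewrite !(coeffB, coeffD, coeff0); ring.
  by exists (LKernel gk).
exists M, i, (fun x => om (i x) + << pth (w (i x)) x >>), g, (mu0 / 4), (k / 2).
split=> // [| |x y ixy|x y xy|s sr st].
- by rewrite mu4 /=; lra.
- by rewrite divr_gt0 //=; lra.
- apply: le_lt_trans (metric_triangle x (w (i x)) y) _.
  rewrite metric_sym; have := wi x; have := wi y; rewrite -ixy; lra.
- by exists (pth x y); apply: pthP; lra.
set x := source s in sr st *; set y := target s in st *.
have wx := wi x; have wy := wi y.
have xw : mdist x (w (i x)) < k / 4 by rewrite metric_sym.
have wij : mdist (w (i x)) (w (i y)) < k.
  apply: le_lt_trans (metric_triangle _ x _) _.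
  have := metric_triangle x y (w (i y)); rewrite (metric_sym y); lra.
have [p pP] := triv x.
rewrite (gE _ _ wij) /gam.
have wk z : mdist (w (i z)) z < k by have := wi z; lra.
have big z : mdist x z < 3 * k -> ball z (mu0 / 4) `<=` ball x mu0.
  move=> xz u; rewrite !ballEmdist /= => zu.
  have := metric_triangle x z u; lra.
have big' z t : mdist x z < 3 * k -> mdist z t < k -> joins (pth z t) (ball x mu0) z t.
  move=> xz zt; have [s1 s2 h] := pthP _ _ zt; split=> //.
  exact: subset_trans h (big _ xz).
have js : joins s (ball x mu0) x y.
  by split=> //; apply: subset_trans sr _; apply: big; rewrite mdistxx; lra.
have xwy : mdist x (w (i y)) < 3 * k.
  have := metric_triangle x y (w (i y)); rewrite (metric_sym y); lra.
have j1 := trivial_pair pP (big' _ _ (_ : mdist x (w (i x)) < 3 * k) (wk x)).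
have {}j1 := j1 ltac:(lra).
have j2 := trivial_pair pP (big' _ _ xwy (wk y)).
have j3 := trivial_pair pP (big' _ _ (_ : mdist x (w (i x)) < 3 * k) wij).
have {}j3 := j3 ltac:(lra).
(* The four sides of the quadrilateral; the values of [p] cancel at its corners. *)
have := bdryB (bdryB (bdryD j1 (trivial_pair pP js)) j2) j3.
congr bdry; apply/eqP/freeg_eqP => q; rewrite !(coeffB, coeffD); ring.
Qed.

Section Walk.
Variables (M : nat) (i : X -> 'I_M) (b : X -> C1) (g : 'I_M -> 'I_M -> cycle1 R X int).
Variables (mu k : R).
Hypotheses (mu0 : 0 < mu) (k0 : 0 < k) (net : chain_net i b g mu k).

Definition walk (L : seq ('I_M * 'I_M)) : C1 := \sum_(q <- L) lkval (g q.1 q.2).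

Lemma path_walk (s : singular R X 1) : exists L,
  bdry (b (source s) + << s >> - b (target s) - walk L).
Proof.
pose P a c := exists L, bdry (b (path_map s a) + << subpath s a c >>
  - b (path_map s c) - walk L).
suff : P 0 1 by rewrite /P path_map0 path_map1 subpath01.
apply: interval_induction => [r r01|a c d ac cd [L hL] [L' hL']].
  have [m [m0 mmu mk]] : exists m : R, [/\ 0 < m, 2 * m <= mu & 2 * m <= k].
    exists (Num.min mu k / 2); rewrite divr_gt0 ?lt_min ?mu0 //.
    by rewrite mulrC divfK ?pnatr_eq0 // !ge_min !lexx orbT.
  have /nbhs_ballP[e e0 eP] := @continuous_path_map R X s r _ (nbhsx_ballx (path_map s r) _ m0).
  exists e => // a c a0 ac c1 ra rc.
  have near (u : R) : a <= u <= c -> mdist (path_map s r) (path_map s u) < m.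
    by move=> auc; rewrite mdist_ball; apply: eP; exact: ltr_dist_between ra rc auc.
  have aca : mdist (path_map s r) (path_map s a) < m by apply: near; rewrite lexx.
  have close (u : R) : a <= u <= c -> mdist (path_map s a) (path_map s u) < 2 * m.
    move=> /near; have := metric_triangle (path_map s a) (path_map s r) (path_map s u).
    rewrite (metric_sym (path_map s a) (path_map s r)); lra.
  have := @net (subpath s a c); rewrite subpath_source subpath_target => h.
  exists [:: (i (path_map s a), i (path_map s c))]; rewrite /walk big_seq1 /=; apply: h.
    move=> _ [v _ <-]; have [u auc ->] := subpath_between s v ac.
    by rewrite -mdist_ball; apply: lt_le_trans (close _ auc) mmu.
  by apply: lt_le_trans (close _ _) mk; rewrite ac lexx.
exists (L ++ L'); rewrite /walk big_cat /=.
have := bdryD (bdryD hL hL') (bdryN (segment_triangle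
  (@continuous_path_map_fst R X s) (a, 0) (c, 0) (d, 0))).
congr bdry; apply/eqP/freeg_eqP => q; rewrite !(coeffN, coeffB, coeffD); ring.
Qed.

Variable Phi : flow R X.

Lemma continuous_orbit x : continuous (fun q : R * R => Phi (x, q.1)).
Proof.
move=> q; apply: (@continuous_comp _ _ _ (fun q : R * R => (x, q.1)) Phi).
  have h : fst q' @[q' --> q] --> fst q by exact: cvg_fst.
  exact: (cvg_pair (cvg_cst x) h).
exact: flow_continuous.
Qed.

Lemma trajectory_segment x s t :
  trajectory Phi (Phi (x, s)) t = segment (@continuous_orbit x) (s, 0) (s + t, 0).
Proof.
apply: singularP => v; rewrite segmentE /= /trajectory_map -flowD.
by congr (Phi (_, _)); rewrite [s + t]addrC addrK -/(param v) mulrC.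
Qed.

Lemma trajectoryD x s t : bdry (<< trajectory Phi x (s + t) >>
  - << trajectory Phi x s >> - << trajectory Phi (Phi (x, s)) t >>).
Proof.
have traj0 r : trajectory Phi x r = segment (@continuous_orbit x) (0, 0) (r, 0).
  by have := trajectory_segment x 0 r; rewrite flow0 add0r.
have := bdryN (segment_triangle (@continuous_orbit x) (0, 0) (s, 0) (s + t, 0)).
rewrite (traj0 (s + t)) (traj0 s) trajectory_segment.
by congr bdry; apply/eqP/freeg_eqP => q; rewrite !(coeffN, coeffB, coeffD); ring.
Qed.

Lemma trajectory_source x t : source (trajectory Phi x t) = x.
Proof. by rewrite /source /= /trajectory_map -/(param _) param_source mul0r flow0. Qed.

Lemma trajectory_target x t : target (trajectory Phi x t) = Phi (x, t).
Proof. by rewrite /target /= /trajectory_map -/(param _) param_target mul1r. Qed.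

(** In time [tau] the flow moves every point by less than [Num.min mu k], so each time step is a
    single transition between cells. Unlike [path_walk], this bounds the length of the walk linearly
    in time. *)
Lemma trajectory_walk : exists2 tau : R, 0 < tau & forall n x t,
  0 <= t <= n%:R * tau -> exists2 L, (size L <= n)%N &
    bdry (b x + << trajectory Phi x t >> - b (Phi (x, t)) - walk L).
Proof.
have m0 : 0 < Num.min mu k by rewrite lt_min mu0.
have [tau tau0 tauP] := flow_small_time cX Phi m0.
exists tau => //; elim=> [|n IH] x t.
  rewrite mul0r -eq_le => /eqP <-; exists [::] => //.
  rewrite /walk big_nil flow0 subr0 addrC addKr.
  by apply: (@null_homologous_cst _ _ _ x) => v; rewrite /= /trajectory_map mulr0 flow0.
move=> /andP[t0 tn]; have [tn'|tn'] := lerP t (n%:R * tau).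
  by have [|L Ln hL] := IH x t; [rewrite t0|exists L => //; exact: leqW].
have [|L Ln hL] := IH x (n%:R * tau).
  by rewrite lexx mulr_ge0 // ltW.
set y := Phi (x, n%:R * tau) in hL *; pose s := t - n%:R * tau.
have s0 : 0 <= s by rewrite subr_ge0 ltW.
have stau : s <= tau by rewrite lerBlDl -[X in _ + X]mul1r -mulrDl natr1.
have small r : 0 <= r <= s -> mdist y (Phi (y, r)) < Num.min mu k.
  by move=> /andP[r0 rs]; apply: tauP; rewrite ger0_norm // (le_trans rs).
exists (rcons L (i y, i (Phi (y, s)))); first by rewrite size_rcons.
have tE : t = n%:R * tau + s by rewrite addrC subrK.
have := @net (trajectory Phi y s).
rewrite trajectory_source trajectory_target => /(_ _ _) h.
have {}h := h _ _; have {h} hs : bdry (b y + << trajectory Phi y s >> - b (Phi (y, s))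
    - lkval (g (i y) (i (Phi (y, s))))).
  apply: h.
    move=> _ [v _ <-]; rewrite /= /trajectory_map -/(param v) -mdist_ball.
    apply: lt_le_trans (small _ _) _; last by rewrite ge_min lexx.
    have /andP[v0 v1] := param_bound v.
    by rewrite mulr_ge0 //= ler_piMl.
  apply: lt_le_trans (small _ _) _; last by rewrite ge_min lexx orbT.
  by rewrite s0 lexx.
rewrite /walk -cats1 big_cat big_seq1 /=.
have D := trajectoryD x (n%:R * tau) s; rewrite -tE -/y in D.
have yE : Phi (x, t) = Phi (y, s) by rewrite /y -flowD -tE.
rewrite yE; have := bdryD (bdryD hL hs) D.
by congr bdry; apply/eqP/freeg_eqP => q; rewrite !(coeffN, coeffB, coeffD); ring.
Qed.

End Walk.
End ChainNet.

(** * Subsequences *)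

Section Subsequences.
Variable R : realType.

Lemma subsequence_of (P : nat -> nat -> Prop) :
  (forall j N, exists2 n, (N <= n)%N & P j n) ->
  exists2 k : nat -> nat, {homo k : m n / (m < n)%N} & forall j, P j (k j).
Proof.
move=> hP; have /choice[f fP] : forall q : nat * nat, exists n, (q.2 <= n)%N /\ P q.1 n.
  by move=> [j N]; have [n Nn Pn] := hP j N; exists n.
pose k := fix k j := if j is j'.+1 then f (j, (k j').+1) else f (0, 0)%N.
exists k; last by case=> [|j]; [exact: (fP (0, 0)%N).2|exact: (fP (j.+1, (k j).+1)).2].
apply: homo_ltn => [a b c|j]; first exact: ltn_trans.
exact: (fP (j.+1, (k j).+1)).1.
Qed.

Lemma compact_subsequence (T : pseudoMetricType R) (A : set T) (x : nat -> T) :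
  compact A -> (forall n, A (x n)) ->
  exists (l : T) (k : nat -> nat), {homo k : m n / (m < n)%N} /\
    forall j, ball l j.+1%:R^-1 (x (k j)).
Proof.
move=> cA xA; have FA : (x @ \oo) A by exists 0%N => // n _; exact: xA.
have [l [_ cl]] := cA (x @ \oo) _ FA.
have [|k kmono kP] := @subsequence_of (fun j n => ball l j.+1%:R^-1 (x n)).
  move=> j N; have j0 : (0 : R) < j.+1%:R^-1 by rewrite invr_gt0.
  have [|_ [[n /= Nn <-] lx]] := cl [set x n | n in [set n | (N <= n)%N]] _ _ (nbhsx_ballx l _ j0).
    by exists N => // n /= Nn; exists n.
  by exists n.
by exists l, k.
Qed.

Lemma homo_ltn_ge_id (k : nat -> nat) : {homo k : m n / (m < n)%N} -> forall n, (n <= k n)%N.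
Proof. by move=> kmono; elim=> // n IH; exact: leq_ltn_trans IH (kmono _ _ (ltnSn n)). Qed.

Lemma near_inv_lt (e : R) : 0 < e -> \forall n \near \oo, (n.+1%:R^-1 : R) < e.
Proof.
move=> e0; have [n] := @ltr_add_invr R 0 e e0; rewrite add0r => ne.
exists n => // m /= nm; apply: le_lt_trans ne.
by rewrite lef_pV2 ?posrE // ler_nat ltnS.
Qed.

End Subsequences.

(** * Norms on finitely spanned real vector spaces *)

Section FiniteDimension.
Variables (R : realType) (V : lmodType R) (N : V -> R).
Hypothesis hN : is_norm N.

Definition spanning k (e : 'I_k -> V) :=
  forall v, exists a : 'I_k -> R, v = \sum_i a i *: e i.

(** A spanning family of least size: a relation with [a i != 0] would express [f i] through the
    others and shorten the family. *)
Lemma spanning_free k (e : 'I_k -> V) : spanning e ->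
  exists r (f : 'I_r -> V), spanning f /\
    forall a : 'I_r -> R, \sum_i a i *: f i = 0 -> forall i, a i = 0.
Proof.
move=> se; have ex : exists r, `[< exists f : 'I_r -> V, spanning f >].
  by exists k; apply/asboolP; exists e.
case: (ex_minnP ex) => r /asboolP[f sf] rmin; exists r, f; split=> // a a0 i.
apply/eqP; apply: contraT => ai.
case: r i f sf rmin a a0 ai => [[//]|r] i f sf rmin a a0 ai.
have : (r.+1 <= r)%N; last by rewrite ltnn.
apply: rmin; apply/asboolP; exists (f \o fintype.lift i) => v.
have [c ->] := sf v.
have fi : f i = \sum_(j < r) (- ((a i)^-1 * a (fintype.lift i j))) *: f (fintype.lift i j).
  have := congr1 (fun u => (a i)^-1 *: u) a0.
  rewrite /= scaler0 (bigD1_ord i) //= scalerDr scalerA mulVf // scale1r.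
  move/eqP; rewrite addr_eq0 => /eqP ->; rewrite scaler_sumr -sumrN.
  by apply: eq_bigr => j _; rewrite scalerA scaleNr.
exists (fun j => c (fintype.lift i j) - c i * ((a i)^-1 * a (fintype.lift i j))).
rewrite (bigD1_ord i) //= {1}fi scaler_sumr -big_split; apply: eq_bigr => j _ /=.
by rewrite scalerA -scalerDl mulrN addrC.
Qed.

Lemma norm0 : N 0 = 0.
Proof. by have [_ NZ _] := hN; rewrite -(scale0r (0 : V)) NZ normr0 mul0r. Qed.

Lemma normN v : N (- v) = N v.
Proof. by have [_ NZ _] := hN; rewrite -scaleN1r NZ normrN1 mul1r. Qed.

Lemma norm_ge0 v : 0 <= N v.
Proof.
have [ND _ _] := hN; have := ND v (- v); rewrite subrr norm0 normN; lra.
Qed.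

Lemma norm_gt0 v : v != 0 -> 0 < N v.
Proof.
have [_ _ N0] := hN; move=> v0; rewrite lt_neqAle norm_ge0 andbT eq_sym.
by apply: contraNneq v0 => /N0 ->.
Qed.

Lemma norm_sum (I : Type) (s : seq I) (F : I -> V) :
  N (\sum_(i <- s) F i) <= \sum_(i <- s) N (F i).
Proof.
have [ND _ _] := hN; elim: s => [|i s IH]; first by rewrite !big_nil norm0.
by rewrite !big_cons; apply: le_trans (ND _ _) _; rewrite lerD2l.
Qed.

Lemma norm_distl u v : N u - N v <= N (u - v).
Proof. by have [ND _ _] := hN; rewrite lerBlDr -{1}[u](subrK v); exact: ND. Qed.

Lemma norm_dist u v : `|N u - N v| <= N (u - v).
Proof.
rewrite ler_norml; apply/andP; split; last exact: norm_distl.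
have := norm_distl v u; rewrite -(normN (v - u)) opprB; lra.
Qed.

Definition combination r (f : 'I_r -> V) (a : 'rV[R]_r) : V := \sum_i a 0 i *: f i.

Lemma combinationB r (f : 'I_r -> V) a b :
  combination f (a - b) = combination f a - combination f b.
Proof. by rewrite /combination -sumrB; apply: eq_bigr => i _; rewrite !mxE scalerBl. Qed.

Lemma combinationZ r (f : 'I_r -> V) c a :
  combination f (c *: a) = c *: combination f a.
Proof. by rewrite /combination scaler_sumr; apply: eq_bigr => i _; rewrite mxE scalerA. Qed.

Lemma coord_le_norm r (a : 'rV[R]_r) i : `|a 0 i| <= `|a|.
Proof. by rewrite [leRHS](mx_normrE a); apply: (le_bigmax _ _ (0, i)). Qed.

Lemma norm_combination_le r (f : 'I_r -> V) a :
  N (combination f a) <= `|a| * \sum_i N (f i).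
Proof.
have [_ NZ _] := hN; apply: le_trans (norm_sum _ _) _.
rewrite mulr_sumr; apply: ler_sum => i _; rewrite NZ.
by rewrite ler_wpM2r ?norm_ge0 ?coord_le_norm.
Qed.

(** On the unit sphere of the coordinates the norm is Lipschitz, and positive by freeness, so
    compactness bounds it below; homogeneity does the rest. Hence any norm [N] controls the
    coordinates. *)
Lemma norm_combination_ge r (f : 'I_r -> V) :
  (forall a : 'I_r -> R, \sum_i a i *: f i = 0 -> forall i, a i = 0) ->
  exists2 C : R, 0 < C & forall a, `|a| <= C * N (combination f a).
Proof.
move=> free; have [_ NZ _] := hN.
pose S := [set a : 'rV[R]_r | `|a| = 1].
have cS : compact S.
  apply: bounded_closed_compact.
    by exists 1; split=> // M M1 a /= ->; exact: ltW.
  apply: (preimage_closed _ (@closed_eq R 1)) => a _; exact: norm_continuous.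
pose B := 1 + \sum_i N (f i).
have B0 : 0 < B by rewrite ltr_pwDl // sumr_ge0 // => i _; exact: norm_ge0.
have lip a b : `|N (combination f a) - N (combination f b)| <= `|a - b| * B.
  apply: le_trans (norm_dist _ _) _; rewrite -combinationB.
  by apply: le_trans (norm_combination_le _ _) _; rewrite ler_wpM2l // /B lerDr.
have [|e e0 eS] := @uniform_radius R 'rV[R]_r S (fun a e => e <= N (combination f a)) cS.
  move=> a Sa; have Na : 0 < N (combination f a).
    apply: norm_gt0; apply/eqP => /(free (a 0)) a0.
    have : a = 0 by apply/rowP => i; rewrite a0 mxE.
    by move=> a00; move: Sa; rewrite /S /= a00 normr0 => /esym /eqP; rewrite oner_eq0.
  (* The first bound keeps [d] below half the norm at [a]; the second keeps the norm from dropping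
     by half when [a] moves to [b]. *)
  pose r0 := Num.min (N (combination f a) / 2) (N (combination f a) / 2 / B).
  exists r0; first by rewrite lt_min !divr_gt0.
  move=> b d _ ab /andP[d0]; rewrite lt_min => /andP[dN _].
  have {}ab : `|a - b| < N (combination f a) / 2 / B.
    apply: lt_le_trans (_ : `|a - b| < r0) _; last by rewrite ge_min lexx orbT.
    by move: ab; rewrite -ball_normE.
  move: ab; rewrite ltr_pdivlMr // => ab.
  have := le_lt_trans (lip a b) ab; rewrite ltr_norml => /andP[_ h]; lra.
exists e^-1 => [|a]; first by rewrite invr_gt0.
have [->|a0] := eqVneq a 0; first by rewrite normr0 mulr_ge0 ?norm_ge0 // invr_ge0 ltW.
have na : 0 < `|a| by rewrite normr_gt0.
rewrite ler_pdivlMl //; have := eS (`|a|^-1 *: a).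
rewrite combinationZ NZ /S /= normrZ !gtr0_norm ?invr_gt0 // mulVf ?gt_eqF //.
by move=> /(_ erefl); rewrite ler_pdivlMl // mulrC.
Qed.

(** Applied to the pairing with xi, whose sign can then be followed along limits in norm. *)
Lemma bounded_functional k (e : 'I_k -> V) (l : V -> R) : spanning e ->
  (forall a u v, l (a *: u + v) = a * l u + l v) ->
  exists2 C : R, 0 <= C & forall v, `|l v| <= C * N v.
Proof.
move=> /spanning_free[r [f [sf free]]] lin.
have [C C0 hC] := norm_combination_ge free.
have l0 : l 0 = 0 by have := lin 1 0 0; rewrite scale1r addr0; lra.
have lsum (a : 'I_r -> R) : l (\sum_i a i *: f i) = \sum_i a i * l (f i).
  by elim/big_rec2: _ => // i y x _ <-; rewrite lin.
have Cl : 0 <= \sum_i `|l (f i)| by exact: sumr_ge0.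
exists (C * \sum_i `|l (f i)|) => [|v]; first by rewrite mulr_ge0 // ltW.
have [a ->] := sf v; pose b := \row_i a i.
have -> : \sum_i a i *: f i = combination f b.
  by apply: eq_bigr => i _; rewrite mxE.
apply: (@le_trans _ _ (`|b| * \sum_i `|l (f i)|)).
  rewrite /combination lsum; apply: le_trans (ler_norm_sum _ _ _) _.
  by rewrite mulr_sumr; apply: ler_sum => i _; rewrite normrM ler_wpM2r ?coord_le_norm.
by rewrite mulrAC ler_wpM2r.
Qed.

Lemma bounded_subsequence k (e : 'I_k -> V) (v : nat -> V) (B : R) : spanning e ->
  (forall n, N (v n) <= B) ->
  exists (u : V) (k : nat -> nat), {homo k : m n / (m < n)%N} /\
    N (v (k n) - u) @[n --> \oo] --> (0 : R).
Proof.
move=> /spanning_free[r [f [sf free]]] vB.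
have [C C0 hC] := norm_combination_ge free.
have /choice[a aE] : forall n, exists a : 'rV[R]_r, v n = combination f a.
  move=> n; have [a ->] := sf (v n); exists (\row_i a i).
  by apply: eq_bigr => i _; rewrite mxE.
pose S := [set a : 'rV[R]_r | `|a| <= C * B].
have cS : compact S.
  apply: bounded_closed_compact.
    by exists (C * B); split=> [|M M1 b /= Sb]; [exact: num_real|exact: le_trans Sb (ltW M1)].
  apply: (preimage_closed _ (@closed_le R (C * B))) => b _; exact: norm_continuous.
have Sa n : S (a n).
  by apply: le_trans (hC _) _; rewrite -aE ler_wpM2l // ltW.
have [l [h [hmono hl]]] := compact_subsequence cS Sa.
exists (combination f l), h; split=> //.
pose D := 1 + \sum_i N (f i).
have D0 : 0 < D by rewrite ltr_pwDl // sumr_ge0 // => i _; exact: norm_ge0.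
apply/cvgrPdist_lt => d d0; have dD : 0 < d / D by rewrite divr_gt0.
apply: filterS (near_inv_lt dD) => n nd.
rewrite sub0r normrN ger0_norm ?norm_ge0 // aE -combinationB.
apply: le_lt_trans (norm_combination_le _ _) _.
have : `|a (h n) - l| < n.+1%:R^-1.
  by have := hl n; rewrite -ball_normE /= distrC.
move=> /lt_trans/(_ nd); rewrite ltr_pdivlMr // => /(le_lt_trans _); apply.
by rewrite ler_wpM2l // lerDr.
Qed.

End FiniteDimension.

(** * Homology classes, change of coefficients and evaluation of the cocycle *)

Section Classes.
Variables (R : realType) (X : topologicalType).
Local Notation bdry := (@null_homologous R X).
Local Notation C1 := (chain R X int 1).

Section Coefficients.
Variable A : nzRingType.
Local Notation cls := (\pi_(homology1 R X A)).

Lemma lkvalD (y z : cycle1 R X A) : lkval (y + z) = lkval y + lkval z.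
Proof. by []. Qed.

Lemma lkvalZ a (z : cycle1 R X A) : lkval (a *: z) = a *: lkval z.
Proof. by []. Qed.

Lemma lkval_sum (I : Type) (s : seq I) (F : I -> cycle1 R X A) :
  lkval (\sum_(i <- s) F i) = \sum_(i <- s) lkval (F i).
Proof. by elim: s => [|i s IH]; rewrite ?big_nil // !big_cons lkvalD IH. Qed.

Lemma class_eq (y z : cycle1 R X A) (w : chain R X A 2) :
  boundary w = lkval y - lkval z -> cls y = cls z.
Proof.
by move=> wE; apply/eqP; rewrite pi_homology_eq; apply/asboolP; exists w.
Qed.

Lemma classD (y z : cycle1 R X A) : cls (y + z) = cls y + cls z.
Proof. exact: raddfD. Qed.

Lemma classZ a (z : cycle1 R X A) : cls (a *: z) = a *: cls z.
Proof. by rewrite -pi_homologyZ. Qed.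

Lemma class_sum (I : Type) (s : seq I) (F : I -> cycle1 R X A) :
  cls (\sum_(i <- s) F i) = \sum_(i <- s) cls (F i).
Proof. exact: raddf_sum. Qed.

Lemma extend_class_pi (z : cycle1 R X int) :
  extend_class A (\pi_(homology1 R X int) z) = cls (extend_cycle A z).
Proof.
have /eqP := reprK (\pi_(homology1 R X int) z).
rewrite pi_homology_eq => /asboolP[w wE].
apply: (@class_eq _ _ (extend_coeff A w)).
by rewrite boundary_extend_coeff wE raddfB.
Qed.

End Coefficients.

Lemma extend_classD (A : nzRingType) (u v : homology1 R X int) :
  extend_class A (u + v) = extend_class A u + extend_class A v.
Proof.
elim/quotW: u => u; elim/quotW: v => v; rewrite -classD !extend_class_pi -classD.
by apply: (@class_eq _ _ _ 0); rewrite linear0 lkvalD /= raddfD subrr.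
Qed.

Lemma extend_class_sum (A : nzRingType) (I : Type) (s : seq I) (F : I -> homology1 R X int) :
  extend_class A (\sum_(i <- s) F i) = \sum_(i <- s) extend_class A (F i).
Proof.
elim: s => [|i s IH]; last by rewrite !big_cons extend_classD IH.
by rewrite !big_nil; apply: (addrI (extend_class A 0)); rewrite -extend_classD !addr0.
Qed.

Section Pairing.
Variable xi : cohomology1 R X.
Local Notation c0 := (lkval (repr xi)).

(** Evaluation of a fixed cocycle in the class on all chains, not only on cycles: open pieces of
    orbits can be measured, and null-homologous chains still get 0. *)
Definition ev (z : C1) : int := cochain_eval c0 z.

Lemma pairingE (A : nzRingType) (z : cycle1 R X A) :
  pairing xi (\pi_(homology1 R X A) z) = cochain_eval c0 (lkval z).
Proof. by rewrite -[xi in LHS]reprK pairing_pi. Qed.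

Lemma pairing_linear (a : R) (u v : homology1 R X R) :
  pairing xi (a *: u + v) = a * pairing xi u + pairing xi v.
Proof.
elim/quotW: u => u; elim/quotW: v => v; rewrite -classZ -classD !pairingE.
by rewrite lkvalD lkvalZ /cochain_eval linearP.
Qed.

Lemma cochain_eval_extend (c : cochain R X 1) (z : C1) :
  cochain_eval c (extend_coeff R z) = (cochain_eval c z)%:~R.
Proof.
rewrite -[z]freeg_sumE !raddf_sum /cochain_eval !linear_sum.
rewrite (big_morph (fun n : int => n%:~R : R) (@intrD R) (erefl _)).
apply: eq_bigr => s _; rewrite /= extend_coeffU !liftU.
by rewrite -[RHS]/((coeff s z * (c s)%:~R)%:~R) intrM intz.
Qed.

Lemma pairing_extend (z : homology1 R X int) :
  pairing xi (extend_class R z) = (pairing xi z)%:~R.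
Proof.
by elim/quotW: z => z; rewrite extend_class_pi !pairingE cochain_eval_extend.
Qed.

Lemma evB y z : ev (y - z) = ev y - ev z. Proof. exact: cochain_evalBr. Qed.
Lemma ev0 : ev 0 = 0. Proof. by rewrite -(subrr (0 : C1)) evB subrr. Qed.
Lemma evN z : ev (- z) = - ev z. Proof. by rewrite -sub0r evB ev0 sub0r. Qed.
Lemma evD y z : ev (y + z) = ev y + ev z.
Proof. by rewrite -[z in LHS]opprK evB evN opprK. Qed.

Lemma ev_sum (I : Type) (s : seq I) (F : I -> C1) :
  ev (\sum_(i <- s) F i) = \sum_(i <- s) ev (F i).
Proof. exact: (big_morph ev evD ev0). Qed.

Lemma ev_bdry z : bdry z -> ev z = 0.
Proof.
move=> [w <-]; rewrite /ev -cochain_eval_coboundary.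
have /eqP -> := lkvalP (repr xi).
rewrite -[0 in LHS](subrr (0 : cochain R X 2)) cochain_evalBl subrr //.
Qed.

End Pairing.

End Classes.

(** * Finite dimension of the first real homology *)

Section Spanning.
Variables (R : realType) (X : metricType R).
Local Notation bdry := (@null_homologous R X).
Local Notation C1 := (chain R X int 1).

Lemma pairing_represents (xi : cohomology1 R X) z c : represents z c -> pairing xi z = ev xi c.
Proof. by move=> [c' <- ->]; rewrite pairingE. Qed.

Lemma cycle_of (z : C1) : boundary z = 0 -> exists c : homology1 R X int, represents c z.
Proof.
move=> /eqP z0; exists (\pi_(homology1 R X int) (LKernel (z0 : z \in lker_pred _))).
by exists (LKernel (z0 : z \in lker_pred _)).
Qed.

Variables (M : nat) (i : X -> 'I_M) (b : X -> C1) (g : 'I_M -> 'I_M -> cycle1 R X int).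
Variables (mu k : R).
Hypotheses (mu0 : 0 < mu) (k0 : 0 < k) (net : chain_net i b g mu k).
Implicit Types (q : 'I_M * 'I_M).

Definition net_class q : homology1 R X R :=
  extend_class R (\pi_(homology1 R X int) (g q.1 q.2)).

Lemma extend_class_walk z c L : represents z c -> bdry (c - walk g L) ->
  extend_class R z = \sum_(q <- L) net_class q.
Proof.
move=> [c' <- ->] [w wE]; rewrite -extend_class_sum -class_sum; congr extend_class.
by apply: (@class_eq _ _ _ _ _ w); rewrite wE lkval_sum.
Qed.

Let G q : cycle1 R X R := extend_cycle R (g q.1 q.2).

Let in_span (y : chain R X R 1) := exists (a : 'I_M * 'I_M -> R) (w : chain R X R 2),
  y = \sum_q a q *: lkval (G q) + boundary w.

Let in_spanD y z : in_span y -> in_span z -> in_span (y + z).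
Proof.
move=> [a [w ->]] [a' [w' ->]]; exists (fun q => a q + a' q), (w + w').
rewrite linearD addrACA -big_split; congr (_ + _).
by apply: eq_bigr => q _; rewrite scalerDl.
Qed.

Let in_spanZ c y : in_span y -> in_span (c *: y).
Proof.
move=> [a [w ->]]; exists (fun q => c * a q), (c *: w).
rewrite scalerDr linearZ scaler_sumr; congr (_ + _).
by apply: eq_bigr => q _; rewrite scalerA.
Qed.

Let in_span_boundary w : in_span (boundary w).
Proof.
by exists (fun=> 0), w; rewrite big1 ?add0r // => q _; rewrite scale0r.
Qed.

Let in_span0 : in_span 0.
Proof. by have := in_span_boundary 0; rewrite linear0. Qed.

Let in_spanG q : in_span (lkval (G q)).
Proof.
exists (fun q' => (q == q')%:R), 0; rewrite linear0 addr0 (bigD1 q) //= eqxx scale1r.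
by rewrite big1 ?addr0 // => q' /negPf; rewrite eq_sym => ->; rewrite scale0r.
Qed.

(** The linear extension of [b] to real 0-chains. Subtracting [bR (boundary y)] brings every chain
    [y] into the span of the net cycles modulo boundaries, so the claim can be checked on single
    simplices; for a cycle the correction vanishes. *)
Let bR : chain R X R 0 -> chain R X R 1 :=
  fglift (fun p : singular R X 0 => extend_coeff R (b (p (vertex R ord0)))).

Let in_span_simplex (s : singular R X 1) : in_span (<< s >> - bR (boundary << s >>)).
Proof.
have [L [w wE]] := path_walk mu0 k0 net s.
have -> : << s >> - bR (boundary << s >>) =
    boundary (extend_coeff R w) + \sum_(q <- L) lkval (G q).
  rewrite boundary_extend_coeff wE boundary1U /bR linearB /= !liftU !scale1r.
  rewrite !raddfB /= raddfD /= extend_coeffU raddf_sum.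
  by apply/eqP/freeg_eqP => j; rewrite !(coeffB, coeffD); ring.
apply: in_spanD; first exact: in_span_boundary.
by elim/big_ind: _ => // q _; exact: in_spanG.
Qed.

Let in_span_chain (y : chain R X R 1) : in_span (y - bR (boundary y)).
Proof.
have -> : y - bR (boundary y) =
    \sum_(s <- dom y) coeff s y *: (<< s >> - bR (boundary << s >>)).
  have yE : y = \sum_(s <- dom y) coeff s y *: << s >>.
    rewrite -{1}[y]freeg_sumE; apply: eq_bigr => s _.
    by rewrite scale_freegU mulr1.
  rewrite {1 2}yE linear_sum /bR linear_sum -sumrB; apply: eq_bigr => s _.
  by rewrite scalerBr; congr (_ - _); rewrite linearZ /= linearZ.
by elim/big_ind: _ => // s _; apply: in_spanZ; exact: in_span_simplex.
Qed.

Lemma net_class_spanning : exists n (e : 'I_n -> homology1 R X R), spanning e.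
Proof.
exists #|{: 'I_M * 'I_M}|, (fun j => net_class (enum_val j)) => v.
elim/quotW: v => z.
have [a [w zE]] := in_span_chain (lkval z).
have z0 : boundary (lkval z) = 0 by exact/eqP/(lkvalP z).
rewrite z0 /bR linear0 subr0 in zE.
exists (fun j => a (enum_val j)).
transitivity (\sum_q a q *: net_class q); last first.
  rewrite (reindex (@enum_val {: 'I_M * 'I_M} predT)) //=.
  exact/onW_bij/enum_val_bij.
transitivity (\pi_(homology1 R X R) (\sum_q a q *: G q)).
  apply: (@class_eq _ _ _ _ _ w); rewrite zE lkval_sum.
  by under [X in _ - X]eq_bigr do rewrite lkvalZ; rewrite addrAC subrr add0r.
rewrite class_sum; apply: eq_bigr => q _.
by rewrite classZ /net_class extend_class_pi.
Qed.

End Spanning.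

(** * Primitives at the given scale, and flow invariance of C_xi *)

Section Scale.
Variables (R : realType) (X : metricType R) (xi : cohomology1 R X).
Local Notation bdry := (@null_homologous R X).
Local Notation c0 := (lkval (repr xi)).
Local Notation ev := (ev xi).

Lemma evU (s : singular R X 1) : ev << s >> = c0 s.
Proof. by rewrite /ev /cochain_eval liftU scale1r intz. Qed.

Lemma locally_constant_path (U : set X) (h : X -> R) (s : singular R X 1) :
  locally_constant_on U h -> range s `<=` U -> h (target s) = h (source s).
Proof.
move=> hU sU; rewrite -path_map0 -path_map1.
apply/esym; apply: (@interval_induction R (fun a c => h (path_map s a) = h (path_map s c))).
  move=> r r01; have Ur a : U (path_map s a) by apply/sU/path_map_range.
  have /nbhs_ballP[e e0 eP] := @continuous_path_map R X s r _ (hU _ (Ur r)).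
  by exists e => // a c _ _ _ ra rc; rewrite (eP a) // (eP c).
by move=> a b c _ _ -> ->.
Qed.

(** On overlaps [f j - f i = h j - h i], so the functions [f i - h i] glue to one [F]. The [h i] are
    constant along paths in [U i], so [F] is still a primitive there; a general path in [B] is cut
    into pieces each lying in some [U i]. *)
Lemma cech_primitive (B : set X) : cech_restriction_eq0 xi B ->
  exists f : X -> R, forall s : singular R X 1, range s `<=` B ->
    (c0 s)%:~R = f (target s) - f (source s).
Proof.
move=> [I [U [g [[oU UB _ [f [fP gP]]] [h [hP gh]]]]]].
have /choice[F FE] : forall x, exists y : R, forall i, U i x -> y = f i x - h i x.
  move=> x; have [[i Ui]|nU] := pselect (exists i, U i x); last first.
    by exists 0 => i Ui; case: nU; exists i.
  exists (f i x - h i x) => j Uj.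
  have := gP i j x Ui Uj; rewrite gh // => e; lra.
have FU i (s : singular R X 1) : range s `<=` U i ->
    (c0 s)%:~R = F (target s) - F (source s).
  move=> sU; have Ut : U i (target s) by apply: sU; exists (vertex R ord_max).
  have Us : U i (source s) by apply: sU; exists (vertex R ord0).
  rewrite (fP _ _ sU) (FE _ _ Ut) (FE _ _ Us).
  rewrite (locally_constant_path (hP i) sU); ring.
exists F => s sB; rewrite -path_map0 -path_map1 -{1}(subpath01 s).
apply: (@interval_induction R (fun a c => (c0 (subpath s a c))%:~R =
  F (path_map s c) - F (path_map s a))); last first.
  move=> a b c _ _ ab bc.
  have := ev_bdry xi (segment_triangle
    (@continuous_path_map_fst R X s) (a, 0) (b, 0) (c, 0)).
  rewrite evD evB !evU => /(congr1 (fun n : int => n%:~R : R)).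
  rewrite rmorphD rmorphB /= -!/(subpath s _ _) ab bc => e; lra.
move=> r r01; have : B (path_map s r) by apply/sB/path_map_range.
rewrite -UB => -[i _ Ui].
have /nbhs_ballP[e e0 eP] := @continuous_path_map R X s r _ (open_nbhs_nbhs (conj (oU i) Ui)).
exists e => // a c a0 ac c1 ra rc.
rewrite (FU i) ?subpath_source ?subpath_target // => _ [v _ <-].
have [u auc ->] := subpath_between s v ac.
by apply: eP; exact: ltr_dist_between ra rc auc.
Qed.

Variables (eps delta0 : R).
Hypothesis hscale : is_scale xi eps delta0.

Lemma scale_primitive (x : X) : exists f : X -> R,
  forall s (y z : X), joins s (ball x (2 * eps)) y z -> (c0 s)%:~R = f z - f y.
Proof.
have [_ _ /(_ x)/cech_primitive[f fP] _] := hscale.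
by exists f => s y z [<- <- sB]; exact: fP.
Qed.

Lemma joins_ballS s (w x y v : X) (r r' : R) :
  joins s (ball w r) x y -> mdist v w <= r' - r -> joins s (ball v r') x y.
Proof.
move=> [sx sy sr] vw; split=> // u /sr; rewrite !ballEmdist /= => wu.
by have := metric_triangle v w u; lra.
Qed.

Lemma joins_scale s (w x y : X) : joins s (ball w eps) x y ->
  joins s (ball x (2 * eps)) x y.
Proof.
move=> js; apply: (joins_ballS js); have [sx _ sr] := js.
have := sr x; rewrite ballEmdist /= metric_sym => /(_ _).
rewrite (_ : 2 * eps - eps = eps); last by ring.
by move=> h; apply/ltW/h; rewrite -sx; exists (vertex R ord0).
Qed.

(** Both paths start at [x], so each lies in the ball of radius [2 * eps] about [x], where one
    primitive computes both values. This accounts for the factor 2 in the definition of a scale. *)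
Lemma scale_path_eq s s' (w w' x y : X) :
  joins s (ball w eps) x y -> joins s' (ball w' eps) x y -> c0 s = c0 s'.
Proof.
move=> /joins_scale js /joins_scale js'; have [f fP] := scale_primitive x.
by apply/eqP; rewrite -(eqr_int R) (fP _ _ _ js) (fP _ _ _ js').
Qed.

Lemma scale_path (x y : X) : mdist x y < delta0 ->
  exists w (s : singular R X 1), joins s (ball w eps) x y.
Proof. by have [_ _ _] := hscale; apply. Qed.

Variable Phi : flow R X.

Lemma associated_cycleP (x : X) t z :
  associated Phi eps 1 (fun=> x) (fun=> t) z <->
  exists s w, joins s (ball w eps) (Phi (x, t)) x /\
    represents z (<< trajectory Phi x t >> + << s >>).
Proof.
split=> [[sigma [js rz]]|[s [w [js rz]]]].
  have [w jw] := js 0%N isT; exists (sigma 1%N), w; split=> //.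
  by rewrite big_ord1 in rz.
exists (fun=> s); split=> [[|//] _|]; first by exists w.
by rewrite big_ord1.
Qed.

Lemma boundary_trajectory x t : boundary (<< trajectory Phi x t >> : chain R X int 1) =
  << point R (Phi (x, t)) >> - << point R x >>.
Proof. by rewrite boundary1U trajectory_source trajectory_target. Qed.

Lemma closing_class x t (s : singular R X 1) U : joins s U (Phi (x, t)) x ->
  exists z : homology1 R X int, represents z (<< trajectory Phi x t >> + << s >>).
Proof.
move=> js; apply: cycle_of.
by rewrite linearD /= boundary_trajectory (boundary_joins js) addrA subrK subrr.
Qed.

(** The square swept out by the path [r] under the flow during time [t]. *)
Lemma flow_square (t : R) (r : singular R X 1) : exists r' : singular R X 1,
  (forall v, r' v = Phi (r v, t)) /\
  bdry (<< trajectory Phi (source r) t >> + << r' >> - << r >>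
    - << trajectory Phi (target r) t >>).
Proof.
have cH : continuous (fun q : R * R => Phi (path_map r q.1, q.2 * t)).
  move=> q; apply: (@continuous_comp _ _ _ (fun q : R * R => (path_map r q.1, q.2 * t)) Phi).
    have h1 : path_map r (fst q') @[q' --> q] --> path_map r (fst q).
      apply: (@continuous_comp _ _ _ fst (path_map r)); first exact: cvg_fst.
      exact: continuous_path_map.
    have h2 : snd q' @[q' --> q] --> snd q by exact: cvg_snd.
    exact: (cvg_pair h1 (cvgMr_tmp h2)).
  exact: flow_continuous.
exists (segment cH (0, 1) (1, 1)); split=> [v|].
  by rewrite segmentE /= subrr mul0r addr0 mul1r subr0 mul1r add0r path_map_param.
have := segment_square cH (0, 0) (0, 1) (1, 1) (1, 0).
have -> : segment cH (0, 0) (0, 1) = trajectory Phi (source r) t.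
  apply: singularP => v; rewrite segmentE /= /trajectory_map -/(param v).
  by rewrite subrr mul0r addr0 path_map0 subr0 mul1r add0r.
have -> : segment cH (0, 0) (1, 0) = r.
  apply: singularP => v; rewrite segmentE /= subrr !mul0r addr0 subr0 mul1r add0r.
  by rewrite mul0r flow0 path_map_param.
have -> // : segment cH (1, 0) (1, 1) = trajectory Phi (target r) t.
apply: singularP => v; rewrite segmentE /= /trajectory_map -/(param v).
by rewrite subrr mul0r addr0 path_map1 subr0 mul1r add0r.
Qed.

Hypothesis cX : compact [set: X].
Hypothesis star : star_neighborhoods X.

Lemma short_square (T e : R) : 0 < e -> exists2 d : R, 0 < d & forall (x y : X) (t : R),
  mdist x y < d -> `|t| <= T -> exists r r' : singular R X 1,
  [/\ joins r (ball x e) x y, joins r' (ball (Phi (x, t)) e) (Phi (x, t)) (Phi (y, t)) &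
   c0 (trajectory Phi x t) + c0 r' = c0 r + c0 (trajectory Phi y t)].
Proof.
move=> e0; have [d1 d10 d1P] := flow_uniform cX Phi T e0.
have m0 : 0 < Num.min e d1 by rewrite lt_min e0.
have [k k0 kP] := short_paths cX star m0.
exists k => // x y t xy tT; have [r [rx ry rr]] := kP _ _ xy.
have [r' [r'E br]] := flow_square t r; exists r, r'; split.
- split=> //; apply: subset_trans rr _; apply: le_ball; rewrite ge_min lexx //.
- split; [by rewrite /source r'E -/(source r) rx|by rewrite /target r'E -/(target r) ry|].
  move=> _ [v _ <-]; rewrite r'E -mdist_ball; apply: d1P => //; rewrite mdist_ball.
  have : ball x (Num.min e d1) (r v) by apply: rr; exists v.
  by apply: le_ball; rewrite ge_min lexx orbT.
- move: (ev_bdry xi br); rewrite !evB evD !evU rx ry => h; lra.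
Qed.

Lemma c0_trajectoryD x s t : c0 (trajectory Phi x (s + t)) =
  c0 (trajectory Phi x s) + c0 (trajectory Phi (Phi (x, s)) t).
Proof. by move: (ev_bdry xi (trajectoryD Phi x s t)); rewrite !evB !evU => h; lra. Qed.

Lemma flowC x s t : Phi (Phi (x, s), t) = Phi (Phi (x, t), s).
Proof. by rewrite -!flowD addrC. Qed.

Lemma chain_recurrent_flow x s : chain_recurrent Phi x -> chain_recurrent Phi (Phi (x, s)).
Proof.
move=> hx d T d0 T1; have [d' d'0 dP] := flow_uniform cX Phi `|s| d0.
have [N [y [t [[[N0 ch] cl] <-]]]] := hx d' T d'0 T1.
exists N, (fun i => Phi (y i, s)), t; split=> //; split; last by rewrite cl.
split=> // i iN; have [Tt yt] := ch i iN; split=> //.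
by rewrite flowC; exact: dP.
Qed.

(** Moving every point of a chain by time [s] changes the evaluation of each step by a difference of
    values on the orbit pieces of length [s] at its two ends. These differences telescope around a
    closed chain. *)
Lemma R_xi_flow x s : R_xi xi Phi eps delta0 x -> R_xi xi Phi eps delta0 (Phi (x, s)).
Proof.
have [eps0 delta00 _ _] := hscale.
move=> hx d T /andP[d0 dd] T1; have [d1 d10 d1P] := flow_uniform cX Phi `|s| d0.
have [d2 d20 d2P] := short_square `|s| eps0.
(* [d1] makes the moved chain a [d]-chain, [d2] provides the short squares, and [d] keeps the
   constant below [delta0]. *)
pose d' := Num.min (Num.min d1 d2) d.
have d'0 : 0 < d' by rewrite !lt_min d10 d20.
have d'd : d' < delta0 by apply: le_lt_trans dd; rewrite ge_min lexx orbT.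
have [|N [y [t [[[N0 ch] cl] y0 Z]]]] := hx d' T _ T1; first by rewrite d'0.
exists N, (fun i => Phi (y i, s)), t; split; [split; [split=> // i iN|by rewrite cl]|by rewrite y0|].
  have [Tt yt] := ch i iN; split=> //.
  rewrite flowC; apply: d1P => //; apply: lt_le_trans yt _.
  by rewrite !ge_min lexx.
move=> z [sigma' [js' rz]].
have /choice[sigma sigmaP] : forall i, exists r : singular R X 1, (i < N)%N ->
    exists w, joins r (ball w eps) (Phi (y i, t i.+1)) (y i.+1).
  move=> i; have [iN|] := boolP (i < N)%N; last first.
    by exists (trajectory Phi x 0).
  have [_ yt] := ch i iN; have [w [r jr]] := scale_path (lt_trans yt d'd).
  by exists r => _; exists w.
pose old i : chain R X int 1 := << trajectory Phi (y i) (t i.+1) >> + << sigma i >>.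
have old0 : boundary (\sum_(i < N) old i) = 0.
  rewrite linear_sum -(big_mkord xpredT (fun i => boundary (old i))).
  rewrite (eq_big_nat _ _ (F2 := fun i => << point R (y i.+1) >> - << point R (y i) >>)).
    by rewrite telescope_sumr // cl subrr.
  move=> i /andP[_ iN]; have [w jr] := sigmaP i iN.
  rewrite /old linearD /= boundary_trajectory (boundary_joins jr).
  by rewrite addrC addrA subrK.
have [z0 rz0] := cycle_of old0.
have : pairing xi z0 = 0.
  (* Closing paths are numbered from 1 in [associated], hence the shift; the value at 0 is
     irrelevant. *)
  apply: Z; exists (fun i => if i is i'.+1 then sigma i' else trajectory Phi x 0).
  by split=> // i iN; exact: sigmaP.
rewrite (pairing_represents _ rz0) (pairing_represents _ rz) !ev_sum => old_ev.
have step i : (i < N)%N -> ev (<< trajectory Phi (Phi (y i, s)) (t i.+1) >> + << sigma' i.+1 >>) =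
    ev (old i) + (c0 (trajectory Phi (y i.+1) s) - c0 (trajectory Phi (y i) s)).
  move=> iN; have [w jr] := sigmaP i iN; have [w' jr'] := js' i iN.
  have [_ yt] := ch i iN.
  have yt2 : mdist (Phi (y i, t i.+1)) (y i.+1) < d2.
    by apply: lt_le_trans yt _; rewrite !ge_min lexx orbT.
  have [r [r' [j1 j2 E]]] := d2P _ _ s yt2 (lexx _).
  rewrite flowC in jr'.
  rewrite /old !evD !evU -(scale_path_eq j1 jr) -(scale_path_eq j2 jr').
  have e1 := c0_trajectoryD (y i) (t i.+1) s.
  have e2 := c0_trajectoryD (y i) s (t i.+1).
  rewrite [s + _]addrC e1 in e2; move: e2 E; lra.
rewrite (eq_bigr _ (fun (i : 'I_N) _ => step i (ltn_ord i))) big_split /= old_ev add0r.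
rewrite -(big_mkord xpredT (fun i => c0 (trajectory Phi (y i.+1) s) - c0 (trajectory Phi (y i) s))).
by rewrite (telescope_sumr (fun i => c0 (trajectory Phi (y i) s))) // cl subrr.
Qed.

Lemma C_xi_flow x s : C_xi xi Phi eps delta0 x -> C_xi xi Phi eps delta0 (Phi (x, s)).
Proof.
move=> [xR xN]; split; first exact: chain_recurrent_flow.
move=> /(@R_xi_flow _ (- s)); rewrite -flowD subrr flow0; exact: xN.
Qed.

End Scale.

(** * Sequences that drop at every return to a label *)

Section Potential.
Variables (R : realType) (M : nat) (l : nat -> 'I_M) (P : nat -> R) (K : R).
Hypothesis K0 : 0 <= K.
Hypothesis step : forall n, P n.+1 <= P n + K.
Hypothesis return_drop : forall j n, (j < n)%N -> l j = l n -> P n <= P j - 1.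

(* Jump from [j] to the last index carrying the same label, and discard it. *)
Lemma potential_gain (S : {set 'I_M}) j n : (j <= n)%N ->
  (forall m, (j <= m <= n)%N -> l m \in S) -> P n <= P j + #|S|%:R * K.
Proof.
elim/ltn_ind: {S}#|S| {1 3}S (erefl #|S|) j => r IH S Sr j jn lS.
have lj : l j \in S by rewrite lS // leqnn.
have ex : exists m, (j <= m <= n)%N && (l m == l j).
  by exists j; rewrite leqnn jn eqxx.
have bnd m : (j <= m <= n)%N && (l m == l j) -> (m <= n)%N by case/andP => /andP[].
case: (ex_maxnP ex bnd) => m /andP[/andP[jm mn] /eqP lm] mmax.
have Pm : P m <= P j.
  move: jm; rewrite leq_eqVlt => /predU1P[->|jm] //.
  by have := return_drop jm (esym lm); lra.
have r0 : (0 < r)%N by rewrite -Sr; apply/card_gt0P; exists (l j).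
have rK : K <= r%:R * K by rewrite ler_peMl // ler1n.
have rK0 := le_trans K0 rK.
move: mn; rewrite leq_eqVlt => /predU1P[<-|mn]; first by lra.
have Sr' : #|S :\ l j| = r.-1 by rewrite -Sr (cardsD1 (l j) S) lj.
have := IH r.-1 _ (S :\ l j) Sr' m.+1 mn.
rewrite prednK // => /(_ (leqnn _)) h.
have {}h : P n <= P m.+1 + r.-1%:R * K.
  apply: h => q /andP[mq qn]; rewrite !inE lS ?qn ?andbT; last first.
    by rewrite (leq_trans jm) // ltnW.
  apply/eqP => lq; have := mmax q.
  by rewrite qn lq eqxx (leq_trans jm (ltnW mq)) /= => /(_ isT); rewrite leqNgt mq.
have -> : (r%:R : R) * K = K + r.-1%:R * K.
  by rewrite -{1}(prednK r0) -natr1 mulrDl mul1r addrC.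
by have := step m; lra.
Qed.

Lemma potential_returns (c : 'I_M) (s : seq nat) x :
  path ltn x s -> l x = c -> {in s, forall y, l y = c} -> P (last x s) <= P x - (size s)%:R.
Proof.
elim: s x => [|y s IH] x /=; first by rewrite subr0.
move=> /andP[xy ys] lx ls; have ly : l y = c by apply: ls; rewrite mem_head.
have ls' : {in s, forall z, l z = c} by move=> z zs; apply: ls; rewrite inE zs orbT.
have h := IH y ys ly ls'; have dr := return_drop xy (etrans lx (esym ly)).
by rewrite -natr1; lra.
Qed.

(** By the pigeonhole principle some label occurs [v > n / M] times up to [n]. From its first to its
    last occurrence [P] drops by at least [v - 1]; before and after, it gains at most [M * K]
    each. *)
Lemma potential_decay n : exists2 v : nat, (n < M * v)%N &
  P n <= P 0%N + 2 * (M%:R * K) + 1 - v%:R.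
Proof.
pose vis c := [seq m <- iota 0 n.+1 | l m == c].
have tot : (\sum_c size (vis c) = n.+1)%N.
  rewrite -[RHS](size_iota 0) -sum1_size.
  under eq_bigr do rewrite size_filter -sum1_count big_mkcond /=.
  rewrite exchange_big /=; apply: eq_bigr => m _.
  by rewrite -big_mkcond /= (big_pred1 (l m)).
have [c cn] : exists c, (n < M * size (vis c))%N.
  apply/existsP; apply: contraT; rewrite negb_exists => /forallP h.
  have M0 : (0 < M)%N by case: (l 0%N) => q /(leq_ltn_trans (leq0n _)).
  have : (\sum_(c < M) M * size (vis c) <= \sum_(c < M) n)%N.
    by apply: leq_sum => c _; rewrite leqNgt.
  by rewrite -big_distrr /= tot sum_nat_const card_ord leq_pmul2l // ltnn.
exists (size (vis c)) => //.
have visP m : m \in vis c -> (m <= n)%N /\ l m = c.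
  by rewrite mem_filter mem_iota add0n ltnS => /andP[/eqP -> /andP[_ ->]].
have srt : sorted ltn (vis c) by apply: sorted_filter (iota_ltn_sorted _ _); exact: ltn_trans.
case: (vis c) cn visP srt => [|x s]; first by rewrite muln0.
move=> _ visP /= pth.
have [xn lx] := visP x (mem_head _ _).
have [yn ly] := visP _ (mem_last x s).
have gain j m : (j <= m)%N -> P m <= P j + M%:R * K.
  move=> jm; have := @potential_gain [set: 'I_M]%SET j m jm; rewrite cardsT card_ord; apply.
  by move=> q _; rewrite inE.
have ls : {in s, forall z, l z = c}.
  by move=> z zs; apply: (visP z _).2; rewrite inE zs orbT.
have h := potential_returns pth lx ls.
have g1 := gain _ _ (leq0n x); have g2 := gain _ _ yn.
rewrite -natr1; lra.
Qed.

End Potential.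

Lemma sum_le_size (R : realType) (I : Type) (L : seq I) (F : I -> R) (B : R) :
  (forall q, F q <= B) -> \sum_(q <- L) F q <= (size L)%:R * B.
Proof.
move=> FB; elim: L => [|q L IH]; first by rewrite big_nil mul0r.
by rewrite big_cons /= -natr1 mulrDl mul1r addrC lerD.
Qed.

(** * Drift along orbits, and its decay under condition (B) *)

Section NetEstimates.
Variables (R : realType) (X : metricType R) (xi : cohomology1 R X).
Variables (eps delta0 : R).
Hypothesis hscale : is_scale xi eps delta0.
Variable Phi : flow R X.
Hypothesis cX : compact [set: X].
Variables (M : nat) (i : X -> 'I_M) (b : X -> chain R X int 1).
Variables (g : 'I_M -> 'I_M -> cycle1 R X int) (mu k : R).
Hypotheses (mu0 : 0 < mu) (k0 : 0 < k) (mu_eps : mu <= eps).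
Hypothesis cell : forall x y : X, i x = i y -> mdist x y < k.
Hypothesis paths : forall x y : X, mdist x y < k ->
  exists s : singular R X 1, joins s (ball x mu) x y.
Hypothesis net : chain_net i b g mu k.
Local Notation bdry := (@null_homologous R X).
Local Notation c0 := (lkval (repr xi)).
Local Notation ev := (ev xi).
Local Notation C := (C_xi xi Phi eps delta0).

(** The end corrections telescope, so additivity in time is exact, and by the net the drift equals
    the sum of the jumps along the walk of the orbit piece. *)
Definition drift (x : X) (t : R) : R :=
  (ev (b x) + c0 (trajectory Phi x t) - ev (b (Phi (x, t))))%:~R.

Definition jump (j l : 'I_M) : R := (ev (lkval (g j l)))%:~R.

Definition jump_bound : R := \sum_(q : 'I_M * 'I_M) `|jump q.1 q.2|.

Lemma jump_bound_ge0 : 0 <= jump_bound.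
Proof. exact: sumr_ge0. Qed.

Lemma jump_le j l : `|jump j l| <= jump_bound.
Proof. by rewrite /jump_bound (bigD1 (j, l)) //= lerDl sumr_ge0. Qed.

Lemma driftD x s t : drift x (s + t) = drift x s + drift (Phi (x, s)) t.
Proof.
by rewrite /drift -intrD c0_trajectoryD -flowD; congr (_%:~R); ring.
Qed.

Lemma drift0 x : drift x 0 = 0.
Proof. by have := driftD x 0 0; rewrite addr0 flow0; lra. Qed.

Lemma ev_walk L : (ev (walk g L))%:~R = \sum_(q <- L) jump q.1 q.2.
Proof.
by rewrite /walk ev_sum (big_morph (fun n : int => n%:~R : R) (@intrD R) (erefl _)).
Qed.

Lemma drift_bound : exists2 tau : R, 0 < tau & forall n x t, 0 <= t <= n%:R * tau ->
  `|drift x t| <= n%:R * jump_bound.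
Proof.
have [tau tau0 tauP] := trajectory_walk cX mu0 k0 net Phi.
exists tau => // n x t tn; have [L Ln bL] := tauP n x t tn.
have -> : drift x t = \sum_(q <- L) jump q.1 q.2.
  rewrite -ev_walk /drift; congr (_%:~R); move: (ev_bdry xi bL).
  by rewrite !evB evD evU => h; lra.
apply: le_trans (ler_norm_sum _ _ _) _.
apply: (@le_trans _ _ ((size L)%:R * jump_bound)).
  by apply: sum_le_size => q; exact: jump_le.
by rewrite ler_wpM2r ?ler_nat ?jump_bound_ge0.
Qed.

Lemma net_path (s : singular R X 1) (x y : X) : joins s (ball x mu) x y -> mdist x y < k ->
  ((ev (b x) + c0 s - ev (b y))%:~R : R) = jump (i x) (i y).
Proof.
move=> [sx sy sr] xy; rewrite /jump; congr (_%:~R).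
have := @net s; rewrite sx sy => /(_ sr xy) bs.
by move: (ev_bdry xi bs); rewrite !evB evD evU => h; lra.
Qed.

(** A closed loop and its orbit piece differ by a single jump, so drift estimates pass to pairings
    with a bounded error. *)
Lemma drift_closing x t (s : singular R X 1) :
  joins s (ball (Phi (x, t)) mu) (Phi (x, t)) x -> mdist (Phi (x, t)) x < k ->
  ((c0 (trajectory Phi x t) + c0 s)%:~R : R) = drift x t + jump (i (Phi (x, t))) (i x).
Proof.
move=> js xk; rewrite -(net_path js xk) /drift -intrD; congr (_%:~R); ring.
Qed.

(** The net relation applies to the constant path at [x], which is null-homologous. Thus a return to
    the same cell has no error term. *)
Lemma jump_diag x : jump (i x) (i x) = 0.
Proof.
pose s : singular R X 1 := singular_of (@cst_continuous _ _ x).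
have js : joins s (ball x mu) x x.
  by split=> // _ [v _ <-]; exact: ballxx.
rewrite -(net_path js) ?mdistxx //.
have := ev_bdry xi (@null_homologous_cst _ _ s x (fun=> erefl)).
by rewrite evU => ->; rewrite addr0 subrr.
Qed.

Section ConditionB.
Variables (d T : R).
Hypotheses (k_d : k <= d) (k_delta0 : k <= delta0) (T1 : 1 < T).
Hypothesis condB : forall x t z, is_cycle Phi d T x t -> C x ->
  associated Phi eps 1 (fun=> x) (fun=> t) z -> pairing xi z <= -1.

Lemma loop_pairing_le x t (s : singular R X 1) : C x -> T <= t ->
  mdist (Phi (x, t)) x < k -> joins s (ball (Phi (x, t)) mu) (Phi (x, t)) x ->
  c0 (trajectory Phi x t) + c0 s <= -1.
Proof.
move=> Cx Tt xk js; have [w [s' js']] := scale_path hscale (lt_le_trans xk k_delta0).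
have [z rz] := closing_class js'.
have : pairing xi z <= -1.
  apply: (condB (x := x) (t := t)) => //.
    by split=> //; rewrite metric_sym; exact: lt_le_trans k_d.
  by apply/associated_cycleP; exists s', w.
have js2 : joins s (ball (Phi (x, t)) eps) (Phi (x, t)) x.
  by case: js => js1 js2 sr; split=> //; exact: subset_trans sr (le_ball mu_eps).
by rewrite (pairing_represents _ rz) evD !evU (scale_path_eq hscale js' js2).
Qed.

Lemma drift_return x t : C x -> T <= t -> i x = i (Phi (x, t)) -> drift x t <= -1.
Proof.
move=> Cx Tt ixt; have xk := cell (esym ixt); have [s js] := paths xk.
have := loop_pairing_le Cx Tt xk js.
rewrite -(ler_int R) (drift_closing js xk) -ixt jump_diag addr0.
by rewrite rmorphN.
Qed.

(** The orbit is sampled at multiples of [T], so that any two samples are far enough apart for (B).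
    The remainder of time below [T] costs one more [K], and [t < n.+1%:R * T <= M%:R * v%:R * T]
    explains the rate [(M%:R * T)^-1]. *)
Lemma drift_decay (star : star_neighborhoods X) :
  exists A c : R, [/\ 0 <= A, 0 < c & forall x t, C x -> 0 <= t -> drift x t <= A - c * t].
Proof.
have T0 : 0 < T by apply: lt_trans T1.
have [tau tau0 tauP] := drift_bound.
pose n0 := (Num.truncn (T / tau)).+1.
have Tn0 : T <= n0%:R * tau.
  rewrite -ler_pdivrMr //; apply: ltW.
  have Tt : 0 <= T / tau by rewrite divr_ge0 // ltW.
  by have /andP[_] := truncn_itv Tt.
pose K := n0%:R * jump_bound.
have K0 : 0 <= K by rewrite mulr_ge0 // jump_bound_ge0.
have KP x t : 0 <= t <= T -> drift x t <= K.
  move=> /andP[t0 tT]; apply: le_trans (ler_norm _) (tauP _ _ _ _).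
  by rewrite t0 (le_trans tT).
have [[x0 _]|X0] := pselect (exists x : X, C x); last first.
  by exists 0, 1; split=> // x t Cx _; case: X0; exists x.
have M0 : (0 : R) < M%:R by rewrite ltr0n; case: (i x0) => q /(leq_ltn_trans (leq0n _)).
exists (2 * (M%:R * K) + 1 + K), (M%:R * T)^-1; split.
- have := mulr_ge0 (ltW M0) K0; lra.
- by rewrite invr_gt0 mulr_gt0.
move=> x t Cx t0; pose n := Num.truncn (t / T).
have /andP[nt tn] : n%:R <= t / T < n.+1%:R.
  by apply: truncn_itv; rewrite divr_ge0 // ltW.
rewrite ler_pdivlMr // in nt; rewrite ltr_pdivrMr // in tn.
pose P m := drift x (m%:R * T).
have PD j m : (j <= m)%N -> P m = P j + drift (Phi (x, j%:R * T)) ((m - j)%:R * T).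
  by move=> jm; rewrite /P -driftD -mulrDl -natrD subnKC.
have step m : P m.+1 <= P m + K.
  rewrite (PD m) // lerD2l subSnn mul1r; apply: KP; by rewrite lexx ltW.
have ret j m : (j < m)%N -> i (Phi (x, j%:R * T)) = i (Phi (x, m%:R * T)) -> P m <= P j - 1.
  move=> jm ijm; rewrite (PD j m (ltnW jm)) lerD2l; apply: drift_return.
  - exact: C_xi_flow.
  - by rewrite ler_peMl ?(ltW T0) // ler1n subn_gt0.
  - by rewrite -flowD -mulrDl -natrD subnKC // ltnW.
have [v nv Pn] := @potential_decay R M (fun m => i (Phi (x, m%:R * T))) P K K0 step ret n.
have P00 : P 0%N = 0 by rewrite /P mul0r drift0.
have tE : t = n%:R * T + (t - n%:R * T) by rewrite addrC subrK.
rewrite tE driftD -tE -/(P n).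
have rest : drift (Phi (x, n%:R * T)) (t - n%:R * T) <= K.
  apply: KP; rewrite subr_ge0 nt /= lerBlDl -[X in _ + X]mul1r -mulrDl.
  by rewrite natr1 ltW.
have : (M%:R * T)^-1 * t <= v%:R.
  rewrite ler_pdivrMl ?mulr_gt0 // mulrAC; apply: le_trans (ltW tn) _.
  by rewrite ler_pM2r // -natrM ler_nat.
rewrite P00 in Pn; lra.
Qed.

End ConditionB.
End NetEstimates.

(** * Rays and their unit representatives *)

Section UnitRepresentative.
Variables (R : realType) (V : lmodType R) (N : V -> R).
Hypothesis hN : is_norm N.

Lemma repr_ray (v : V) : exists2 a : R, 0 < a & repr (\pi_(ray V) v) = a *: v.
Proof.
have : same_ray v (repr (\pi_(ray V) v)).
  by have /eqP := reprK (\pi_(ray V) v); rewrite eqmodE same_ray_sym.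
by move=> /asboolP[a a0 e]; exists a.
Qed.

Lemma unit_repr_pi (v : V) : unit_repr N (\pi_(ray V) v) = (N v)^-1 *: v.
Proof.
rewrite /unit_repr; have [a a0 ->] := repr_ray v; have [_ NZ _] := hN.
by rewrite NZ gtr0_norm // scalerA invfM mulrAC mulVf ?mul1r // gt_eqF.
Qed.

Lemma norm_unit (v : V) : N ((N v)^-1 *: v) = (v != 0)%:R.
Proof.
have [_ NZ _] := hN; have [->|v0] := eqVneq v 0; first by rewrite scaler0 norm0.
rewrite NZ ger0_norm ?invr_ge0 ?norm_ge0 // mulVf // gt_eqF //.
exact: norm_gt0.
Qed.

(** The norm of the limit is again 0 or 1, so [u] is its own unit representative and its ray is the
    limit of the rays. *)
Lemma unit_limit (v : nat -> V) (u : V) :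
  (forall n, N (v n) = 0 \/ N (v n) = 1) -> N (v n - u) @[n --> \oo] --> (0 : R) ->
  (N u)^-1 *: u = u.
Proof.
move=> v01 vu; have [_ _ N0] := hN.
have [/N0 ->|Nu0] := eqVneq (N u) 0; first by rewrite scaler0.
have [->|Nu1] := eqVneq (N u) 1; first by rewrite invr1 scale1r.
pose e := Num.min `|N u| `|1 - N u|.
have e0 : 0 < e by rewrite lt_min !normr_gt0 Nu0 subr_eq0 eq_sym.
move/cvgrPdist_lt : vu => /(_ e e0) /filter_ex[n /=].
rewrite sub0r normrN ger0_norm ?norm_ge0 // => vn.
have := le_lt_trans (norm_dist hN (v n) u) vn.
rewrite lt_min; case: (v01 n) => ->; first by rewrite sub0r normrN ltxx.
by rewrite ltxx andbF.
Qed.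

End UnitRepresentative.

(** * Almost closed orbits of bounded time, and their multiples *)

Section Iterates.
Variables (R : realType) (X : metricType R) (Phi : flow R X).
Hypothesis cX : compact [set: X].

(** If the [j]-th iterate is still close to [y], uniform continuity of the flow for times up to [T]
    puts the next one close to [Phi (y, t)], hence to [x]. *)
Lemma flow_iterate (T e : R) (m : nat) : 0 < e -> exists2 d : R, 0 < d &
  forall x y t, `|t| <= T -> mdist x y < d -> mdist x (Phi (y, t)) < d ->
  forall j, (j <= m)%N -> mdist x (Phi (y, j%:R * t)) < e.
Proof.
move=> e0; elim: m e e0 => [|m IH] e e0.
  by exists e => // x y t _ xy _ j; rewrite leqn0 => /eqP ->; rewrite mul0r flow0.
have e20 : 0 < e / 2 by rewrite divr_gt0.
have [d1 d10 d1P] := flow_uniform cX Phi T e20.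
have m0 : 0 < Num.min e (d1 / 2) by rewrite lt_min e0 divr_gt0.
have [d2 d20 d2P] := IH _ m0.
exists (Num.min d2 (Num.min (d1 / 2) (e / 2))).
  by rewrite !lt_min d20 !divr_gt0.
move=> x y t tT; rewrite !lt_min => /and3P[xy2 xy1 xye] /and3P[xt2 xt1 xte] [|j] jm.
  by rewrite mul0r flow0; lra.
have := d2P x y t tT xy2 xt2 j jm; rewrite lt_min => /andP[_ xj].
have yj : mdist (Phi (y, j%:R * t)) y < d1.
  by have := metric_triangle (Phi (y, j%:R * t)) x y; rewrite metric_sym in xj; lra.
have := d1P _ _ t tT yj; rewrite -flowD [X in X < _]metric_sym => h.
have := metric_triangle x (Phi (y, t)) (Phi (y, j%:R * t + t)).
move=> h'.
have -> : j.+1%:R * t = j%:R * t + t by rewrite -natr1 mulrDl mul1r.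
lra.
Qed.

End Iterates.

Section LoopMultiples.
Variables (R : realType) (X : metricType R) (xi : cohomology1 R X).
Variables (eps delta0 : R).
Hypothesis hscale : is_scale xi eps delta0.
Variable Phi : flow R X.
Hypothesis cX : compact [set: X].
Hypothesis star : star_neighborhoods X.
Local Notation c0 := (lkval (repr xi)).

(* The loops closing up the orbits of nearby points over the same time are
   homologous, so the loop over time [m t] is [m] times the loop over time [t]. *)
Lemma loop_multiple (T : R) (m : nat) : exists2 d : R, 0 < d &
  forall (x y : X) (t : R) (s s' : singular R X 1), `|t| <= T ->
  mdist x y < d -> mdist x (Phi (y, t)) < d ->
  joins s (ball x (2 * eps)) (Phi (y, t)) y ->
  joins s' (ball x (2 * eps)) (Phi (y, m%:R * t)) y ->
  c0 (trajectory Phi y (m%:R * t)) + c0 s' =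
    m%:R * (c0 (trajectory Phi y t) + c0 s).
Proof.
have [eps0 _ _ _] := hscale.
have [d1 d10 d1P] := short_square xi Phi cX star T eps0.
pose e := Num.min eps (d1 / 2).
have e0 : 0 < e by rewrite lt_min eps0 divr_gt0.
(* One iterate beyond [m]: [leq] treats pieces starting at the [m]-th iterate, and their end point
   must be near [x] too. *)
have [d d0 dP] := flow_iterate Phi cX T m.+1 e0.
exists d => // x y t s s' tT xy xt js js'.
have near j : (j <= m.+1)%N -> mdist x (Phi (y, j%:R * t)) < eps /\
    mdist x (Phi (y, j%:R * t)) < d1 / 2.
  by move=> jm; have := dP x y t tT xy xt j jm; rewrite lt_min => /andP[].
have [f fP] := scale_primitive hscale x.
(* The value on an orbit piece closed up near [x], with the closing path read off from the primitive
   [f]; the terms in [f] telescope, so [l] is additive in time. *)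
pose l (z : X) (r : R) : R := (c0 (trajectory Phi z r))%:~R + f z - f (Phi (z, r)).
have lD z r r' : l z (r + r') = l z r + l (Phi (z, r)) r'.
  by rewrite /l c0_trajectoryD intrD -flowD; ring.
have leq j : (j <= m)%N -> l (Phi (y, j%:R * t)) t = l y t.
  move=> jm; set p := Phi (y, j%:R * t).
  have [pe pd] := near j (leqW jm); rewrite -/p in pe pd.
  have [ye yd] := near 0%N isT; rewrite mul0r flow0 in ye yd.
  have yp : mdist p y < d1.
    by have := metric_triangle p x y; rewrite (metric_sym p x); lra.
  have [r [r' [jr jr' E]]] := d1P p y t yp tT.
  have {}jr := fP _ _ _ (joins_ballS (r' := 2 * eps) jr _).
  have {}jr : (c0 r)%:~R = f y - f p by apply: jr; lra.
  have pte : mdist x (Phi (p, t)) < eps.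
    by rewrite /p -flowD -{2}[t]mul1r -mulrDl natr1; have [] := near j.+1 jm.
  have {}jr' := fP _ _ _ (joins_ballS (r' := 2 * eps) jr' _).
  have {}jr' : (c0 r')%:~R = f (Phi (y, t)) - f (Phi (p, t)) by apply: jr'; lra.
  move: E => /(congr1 (fun n : int => n%:~R : R)); rewrite !intrD jr jr' /l; lra.
have lm j : (j <= m.+1)%N -> l y (j%:R * t) = j%:R * l y t.
  elim: j => [_|j IH jm]; last first.
    rewrite -natr1 !mulrDl !mul1r lD (IH (ltnW jm)) (leq j) //.
  by rewrite !mul0r; have := lD y 0 0; rewrite addr0 flow0; lra.
apply/eqP; rewrite -(eqr_int R) rmorphM /= !intrD natz.
rewrite (fP _ _ _ js) (fP _ _ _ js').
have := lm m (leqnSn m); rewrite /l => h; apply/eqP.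
rewrite -[X in X * _]/(m%:R : R).
by rewrite addrA [X in X = _]addrAC -addrA; lra.
Qed.

End LoopMultiples.

(** * The two implications *)

Section Equivalence.
Variables (R : realType) (X : metricType R) (xi : cohomology1 R X).
Variables (eps delta0 : R).
Hypothesis hscale : is_scale xi eps delta0.
Variables (Phi : flow R X) (nrm : homology1 R X R -> R).
Hypothesis hnrm : is_norm nrm.
Hypothesis cX : compact [set: X].
Hypothesis star : star_neighborhoods X.
Local Notation bdry := (@null_homologous R X).
Local Notation c0 := (lkval (repr xi)).
Local Notation C := (C_xi xi Phi eps delta0).

Lemma class_norm_bound M (i : X -> 'I_M) b g (mu k : R) : 0 < mu -> 0 < k ->
  chain_net i b g mu k -> exists2 D : R, 0 < D &
  forall x t (s : singular R X 1) z, 1 < t ->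
    joins s (ball (Phi (x, t)) mu) (Phi (x, t)) x -> mdist (Phi (x, t)) x < k ->
    represents z (<< trajectory Phi x t >> + << s >>) ->
    nrm (extend_class R z) <= D * t.
Proof.
move=> mu0 k0 net; have [tau tau0 tauP] := trajectory_walk cX mu0 k0 net Phi.
pose B := \sum_q nrm (net_class g q).
have B0 : 0 <= B by apply: sumr_ge0 => q _; exact: norm_ge0.
have BP q : nrm (net_class g q) <= B.
  by rewrite /B (bigD1 q) //= lerDl; apply: sumr_ge0 => q' _; exact: norm_ge0.
have ti0 : 0 < tau^-1 by rewrite invr_gt0.
(* The walk has at most [n.+1] steps with [n <= t / tau], and closing adds one; [1 < t] turns the
   extra 2 into [2 * t]. The final 1 makes the constant positive even if [B] is 0. *)
exists ((tau^-1 + 2) * B + 1).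
  by rewrite ltr_wpDl // mulr_ge0 // addr_ge0 // ltW.
move=> x t s z t1 js xk rz; have t0 : 0 < t by apply: lt_trans t1.
pose n := Num.truncn (t / tau).
have /andP[nt tn] : n%:R <= t / tau < n.+1%:R.
  by apply: truncn_itv; rewrite divr_ge0 // ltW.
have [|L Ln bL] := tauP n.+1 x t.
  by rewrite ltW //= -ler_pdivrMr // ltW.
have [sx sy sr] := js.
have := @net s; rewrite sx sy => /(_ sr xk) bs.
have bz : bdry (<< trajectory Phi x t >> + << s >>
    - walk g (rcons L (i (Phi (x, t)), i x))).
  rewrite /walk -cats1 big_cat big_seq1 /=.
  have := bdryD bL bs; congr bdry.
  by apply/eqP/freeg_eqP => j; rewrite !(coeffB, coeffD); ring.
rewrite (extend_class_walk rz bz); apply: le_trans (norm_sum hnrm _ _) _.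
apply: le_trans (sum_le_size _ BP) _; rewrite size_rcons.
have Lt : ((size L).+1%:R : R) <= (tau^-1 + 2) * t.
  apply: (@le_trans _ _ (n.+2%:R)); first by rewrite ler_nat.
  by rewrite -!natr1 mulrDl [tau^-1 * t]mulrC; lra.
have h := ler_wpM2r B0 Lt.
by rewrite (_ : (_ * B + 1) * t = (tau^-1 + 2) * t * B + t); [lra|ring].
Qed.

(** For [t >= ts] half of [c * t] absorbs the error [A + J]. For [t < ts] the loop over [m%:R * t]
    has a negative value because [c * m%:R] exceeds [A + J] and [1 < t]; that value is [m] times the
    integer [p], so [p <= -1]. *)
Lemma loop_estimate : condition_B xi Phi eps delta0 ->
  exists r c D : R, [/\ 0 < r, 0 < c, 0 < D &
  forall x y t (s : singular R X 1) z, C y -> 1 < t -> mdist x y < r ->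
    mdist x (Phi (y, t)) < r -> joins s (ball x r) (Phi (y, t)) y ->
    represents z (<< trajectory Phi y t >> + << s >>) ->
    (pairing xi z)%:~R <= - c * t /\ nrm (extend_class R z) <= D * t].
Proof.
move=> [dB [T [dB0 T1 condB]]]; have [eps0 delta00 _ _] := hscale.
pose e := Num.min eps (Num.min dB delta0).
have e0 : 0 < e by rewrite !lt_min eps0 dB0.
have [M [i [b [g [mu [k [/andP[mu0 mue] /andP[k0 ke] cell paths net]]]]]]] :=
  chain_net_exists cX star e0.
have [mu_eps _ _] : [/\ mu <= eps, mu <= dB & mu <= delta0].
  by move: mue; rewrite !le_min => /and3P[].
have [k_eps k_dB k_delta0] : [/\ k <= eps, k <= dB & k <= delta0].
  by move: ke; rewrite !le_min => /and3P[].
have [A [c [A0 cc0 dec]]] :=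
  drift_decay hscale cX mu0 k0 mu_eps cell paths net k_dB k_delta0 T1 condB star.
have [D D0 normD] := class_norm_bound mu0 k0 net.
pose J := jump_bound xi g.
have J0 : 0 <= J by exact: jump_bound_ge0.
have AJ : 0 <= (A + J) / c by rewrite divr_ge0 ?addr_ge0 // ltW.
pose ts := 2 * ((A + J) / c).
pose m := (Num.truncn ((A + J) / c)).+1.
have mc : A + J < c * m%:R.
  by have /andP[_] := truncn_itv AJ; rewrite ltr_pdivrMr // mulrC.
have [d1 d10 d1P] := loop_multiple hscale Phi cX star ts m.
have k20 : 0 < k / 2 by rewrite divr_gt0.
have [d2 d20 d2P] := flow_iterate Phi cX ts m k20.
pose r := Num.min (Num.min (mu / 2) (k / 2)) (Num.min d1 d2).
have r0 : 0 < r by rewrite !lt_min d10 d20 k20 divr_gt0.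
have [rmu rk rd1 rd2] : [/\ r <= mu / 2, r <= k / 2, r <= d1 & r <= d2].
  by have : r <= r by []; rewrite {2}/r !le_min => /andP[/andP[-> ->] /andP[-> ->]].
have ts0 : 0 < ts + 1 by rewrite ltr_wpDl // mulr_ge0.
(* For short loops the bound -1 becomes proportional to [t] because [t <= ts + 1]. *)
pose c' := Num.min (c / 2) (ts + 1)^-1.
have c'0 : 0 < c' by rewrite lt_min divr_gt0 // invr_gt0.
exists r, c', D; split=> // x y t s z Cy t1 xy xt js rz.
have jJ j l : `|jump xi g j l| <= J by exact: jump_le.
have mnat : (0 < m)%N by [].
have tsE : c * ts = 2 * (A + J) by rewrite /ts mulrCA [c * (_ / c)]mulrC divfK ?gt_eqF.
have c'2 : c' <= c / 2 by rewrite ge_min lexx.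
have c'ts : c' <= (ts + 1)^-1 by rewrite ge_min lexx orbT.
clear mue ke; clearbody J ts r c' m e.
have t0 : 0 < t by apply: lt_trans t1.
have js1 : joins s (ball (Phi (y, t)) mu) (Phi (y, t)) y.
  apply: (joins_ballS js); rewrite metric_sym.
  by clear -hscale hnrm cX star xt rmu; lra.
have yk : mdist (Phi (y, t)) y < k.
  have tri := metric_triangle (Phi (y, t)) x y; rewrite (metric_sym _ x) in tri.
  by clear -hscale hnrm cX star tri xy xt rk; lra.
split; last exact: normD js1 yk rz.
rewrite (pairing_represents _ rz) evD !evU.
have p_le : ((c0 (trajectory Phi y t) + c0 s)%:~R : R) <= A - c * t + J.
  rewrite (drift_closing xi net js1 yk) lerD //; first exact: dec (ltW t0).
  exact: le_trans (ler_norm _) (jJ _ _).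
have [tst|tst] := lerP ts t.
  apply: le_trans p_le _; have ct : c' * t <= c / 2 * t.
    by rewrite ler_pM2r.
  have : c * ts <= c * t by rewrite ler_pM2l.
  by rewrite tsE => h; clear -hscale hnrm cX star ct h; lra.
have tT : `|t| <= ts by rewrite gtr0_norm // ltW.
have xmt : mdist x (Phi (y, m%:R * t)) < k / 2.
  by apply: (d2P x y t tT _ _ m (leqnn m)); apply: lt_le_trans rd2.
have ymk : mdist (Phi (y, m%:R * t)) y < k.
  have tri := metric_triangle (Phi (y, m%:R * t)) x y; rewrite (metric_sym _ x) in tri.
  by clear -hscale hnrm cX star tri xmt xy rk; lra.
have [s' js'] := paths _ _ ymk.
have js2 : joins s (ball x (2 * eps)) (Phi (y, t)) y.
  apply: (joins_ballS js); rewrite mdistxx.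
  by clear -hscale hnrm cX star mu_eps rmu mu0 eps0; lra.
have js'2 : joins s' (ball x (2 * eps)) (Phi (y, m%:R * t)) y.
  apply: (joins_ballS js').
  by clear -hscale hnrm cX star xmt mu_eps k_eps k0; lra.
have := d1P x y t s s' tT (lt_le_trans xy rd1) (lt_le_trans xt rd1) js2 js'2.
set p := c0 (trajectory Phi y t) + c0 s => E.
have mp : (m%:R * p)%:~R < 0 :> R.
  rewrite -E (drift_closing xi net js' ymk).
  have mt0 : 0 <= m%:R * t by rewrite mulr_ge0 // ltW.
  have h1 := dec _ _ Cy mt0.
  have h2 := le_trans (ler_norm _) (jJ (i (Phi (y, m%:R * t))) (i y)).
  have h3 : c * m%:R <= c * m%:R * t.
    by apply: ler_peMr (ltW t1); rewrite mulr_ge0 // ltW.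
  by rewrite mulrA in h1; clear -hscale hnrm cX star h1 h2 h3 mc; lra.
have m0 : (0 : int) < m%:R by rewrite ltr0n.
have p0 : p < 0 by rewrite -(pmulr_rlt0 _ m0) -(ltrz0 R).
have p1 : p <= -1 by clear -p0; lia.
apply: (@le_trans _ _ (-1)).
  by rewrite -(ler_int R) rmorphN in p1.
rewrite mulNr lerN2; apply: (@le_trans _ _ ((ts + 1)^-1 * t)).
  by rewrite ler_pM2r.
by rewrite ler_pdivrMl // mulr1; clear -hscale hnrm cX star tst; lra.
Qed.

Lemma pairingB (u v : homology1 R X R) : pairing xi (u - v) = pairing xi u - pairing xi v.
Proof. by rewrite -[- v]scaleN1r addrC pairing_linear mulN1r addrC. Qed.

Lemma pairing0 : pairing xi (0 : homology1 R X R) = 0.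
Proof. by have := pairingB 0 0; rewrite !subrr. Qed.

Lemma pairingZ a (u : homology1 R X R) : pairing xi (a *: u) = a * pairing xi u.
Proof. by rewrite -[a *: u]addr0 pairing_linear pairing0 addr0. Qed.

Lemma homology_spanning : exists n (e : 'I_n -> homology1 R X R), spanning e.
Proof.
have [M [i [b [g [mu [k [/andP[mu0 _] /andP[k0 _] _ _ net]]]]]]] :=
  chain_net_exists cX star ltr01.
exact: net_class_spanning mu0 k0 net.
Qed.

Lemma pairing_bounded : exists2 B : R, 0 <= B &
  forall u : homology1 R X R, `|pairing xi u| <= B * nrm u.
Proof.
have [n [e se]] := homology_spanning.
exact: (bounded_functional hnrm se (pairing_linear xi)).
Qed.

(** Value at most [- c * t] and norm at most [D * t] give at most [- (c / D)] on unit
    representatives, independently of [t]; a bounded functional carries this to the limit. *)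
Lemma condition_B_fried : condition_B xi Phi eps delta0 ->
  fried_condition xi Phi nrm eps delta0.
Proof.
move=> /loop_estimate[r [c [D [r0 cc0 D0 est]]]] x xs ts d [ts1 xsx xtx] Cxs.
move=> [z [kk [zc kmono cvgd]]].
have [B B0 BP] := pairing_bounded.
have cD : 0 < c / D by rewrite divr_gt0.
have near_est : \forall n \near \oo, pairing xi (unit_repr nrm (direction (z n))) <= - (c / D).
  have h1 := xsx _ (nbhsx_ballx x r r0).
  have h2 := xtx _ (nbhsx_ballx x r r0).
  near=> n.
  have [s [js rz]] : exists s : singular R X 1, joins s (ball x r) (Phi (xs n, ts n)) (xs n) /\
      represents (z n) (<< trajectory Phi (xs n) (ts n) >> + << s >>).
    by near: n; exact: zc.
  have [||pz nz] := est x _ _ _ _ (Cxs n) (ts1 n) _ _ js rz.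
  - by rewrite mdist_ball; near: n.
  - by rewrite mdist_ball; near: n.
  rewrite unit_repr_pi // pairingZ pairing_extend.
  have t0 : 0 < ts n by apply: lt_trans (ts1 n).
  have v0 : extend_class R (z n) != 0.
    apply/eqP => z0; move: pz; rewrite -pairing_extend z0 pairing0.
    by rewrite mulNr lerNr oppr0 leNgt mulr_gt0.
  have N0 := norm_gt0 hnrm v0.
  rewrite ler_pdivrMl //; apply: le_trans pz _.
  rewrite mulNr mulrN lerN2; apply: le_trans (ler_wpM2r (ltW cD) nz) _.
  by rewrite mulrAC [c / D]mulrC mulrA divff ?mul1r // gt_eqF.
have nonneg : 0 <= nrm (repr d) by exact: norm_ge0.
suff : pairing xi (unit_repr nrm d) < 0.
  rewrite /unit_repr pairingZ; apply: contraTT; rewrite -!leNgt => p0.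
  by rewrite mulr_ge0 // invr_ge0.
(* Within this distance the pairing changes by less than [c / D]; [B + 1] avoids division by 0. *)
have e0 : 0 < c / D / (B + 1) by rewrite divr_gt0 // ltr_wpDl.
move/cvgrPdist_lt : cvgd => /(_ _ e0) near_d.
have [N _ NP] := near_est.
have [n [/= nd nN]] : exists n, `|0 - nrm (unit_repr nrm (direction (z (kk n))) - unit_repr nrm d)|
    < c / D / (B + 1) /\ (N <= n)%N.
  have [N' _ N'P] := near_d; exists (maxn N N'); split; last by rewrite leq_maxl.
  by apply: N'P; rewrite /= leq_maxr.
have pn := NP (kk n) (leq_trans nN (homo_ltn_ge_id kmono n)).
have := BP (unit_repr nrm (direction (z (kk n))) - unit_repr nrm d).
rewrite pairingB; move: nd; rewrite sub0r normrN ger0_norm ?norm_ge0 //.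
rewrite ltr_pdivlMr ?ltr_wpDl // mulrDr mulr1 [_ * B]mulrC => nd.
have nn := norm_ge0 hnrm (unit_repr nrm (direction (z (kk n))) - unit_repr nrm d).
rewrite /= in pn; rewrite ler_norml => /andP[h1 h2]; lra.
Unshelve. all: by end_near.
Qed.

(** A violation of (B) closes up by a path that is only known to lie in a ball of radius [eps]. It
    is replaced by a short path near the end point, which by the scale does not change the
    pairing. *)
Lemma short_loops_of_not_B : ~ condition_B xi Phi eps delta0 -> forall n : nat,
  exists q : X * R * homology1 R X int,
  [/\ C q.1.1, 1 < q.1.2, mdist q.1.1 (Phi q.1) < n.+1%:R^-1, 0 <= pairing xi q.2 &
    exists s : singular R X 1,
      joins s (ball (Phi q.1) n.+1%:R^-1) (Phi q.1) q.1.1 /\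
      represents q.2 (<< trajectory Phi q.1.1 q.1.2 >> + << s >>)].
Proof.
move=> nB n; have [eps0 delta00 _ _] := hscale.
have n0 : (0 : R) < n.+1%:R^-1 by rewrite invr_gt0.
have e0 : 0 < Num.min n.+1%:R^-1 eps by rewrite lt_min n0.
have [k k0 kP] := short_paths cX star e0.
(* With [T = 2] the offending cycles satisfy [1 < t], as closing sequences demand. *)
apply: contrapT => nq; apply: nB; exists (Num.min k n.+1%:R^-1), 2; split.
- by rewrite lt_min k0.
- by rewrite ltr1n.
move=> x t z [t2 xt] Cx /associated_cycleP[s [w [js rz]]].
move: xt; rewrite lt_min => /andP[xk xn].
have [|s' js'] := kP (Phi (x, t)) x; first by rewrite metric_sym.
have [js1 js2] : joins s' (ball (Phi (x, t)) n.+1%:R^-1) (Phi (x, t)) x /\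
    joins s' (ball (Phi (x, t)) eps) (Phi (x, t)) x.
  by case: js' => ? ? h; split; split=> //; apply: subset_trans h _; apply: le_ball;
    rewrite ge_min lexx ?orbT.
have [z' rz'] := closing_class js1.
have zz' : pairing xi z' = pairing xi z.
  by rewrite !(pairing_represents _ rz, pairing_represents _ rz') !evD !evU
    (scale_path_eq hscale js2 js).
rewrite leNgt; apply/negP => z1; apply: nq; exists (x, t, z'); split=> //=.
- by apply: lt_le_trans t2; rewrite ltr1n.
- by rewrite zz'; move: z1; clear; move: (pairing xi z) => p; lia.
- by exists s'.
Qed.

(** [k1] makes the base points converge and [k2] the unit representatives; the times may be
    unbounded. The limit [u] may be 0, and then too a pairing at least 0 contradicts Fried's
    condition. *)
Lemma fried_condition_B : fried_condition xi Phi nrm eps delta0 ->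
  condition_B xi Phi eps delta0.
Proof.
move=> fried; apply: contrapT => /short_loops_of_not_B /choice[q qP].
have [l [k1 [k1mono k1P]]] :=
  compact_subsequence cX (fun n => I : [set: X] (q n).1.1).
pose v n := extend_class R (q (k1 n)).2.
have v1 n : nrm ((nrm (v n))^-1 *: v n) <= 1.
  by rewrite norm_unit //; case: (_ != _).
have [B B0 BP] := pairing_bounded.
have [n0 [e se]] := homology_spanning.
have [u [k2 [k2mono k2u]]] := bounded_subsequence hnrm se v1.
have uE : (nrm u)^-1 *: u = u.
  apply: (@unit_limit _ _ _ hnrm (fun n => (nrm (v (k2 n)))^-1 *: v (k2 n))) k2u => n.
  by rewrite norm_unit //; case: (_ != _); [right|left].
have small (d : R) : 0 < d -> \forall n \near \oo, ((k1 n).+1%:R^-1 : R) < d.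
  move=> d0; apply: filterS (near_inv_lt d0) => n nd; apply: le_lt_trans nd.
  by rewrite lef_pV2 ?posrE // ler_nat ltnS homo_ltn_ge_id.
have near_x (d : R) : 0 < d -> \forall n \near \oo, mdist l (q (k1 n)).1.1 < d.
  move=> d0; apply: filterS (near_inv_lt d0) => n nd.
  by apply: lt_trans nd; rewrite mdist_ball; exact: k1P.
have near_xt (d : R) : 0 < d -> \forall n \near \oo, mdist l (Phi (q (k1 n)).1) < d.
  move=> d0; have d20 : 0 < d / 2 by rewrite divr_gt0.
  near=> n; have [_ _ h _ _] := qP (k1 n).
  have h1 : mdist l (q (k1 n)).1.1 < d / 2 by near: n; exact: near_x.
  have h2 : (k1 n).+1%:R^-1 < d / 2 by near: n; exact: small.
  have h3 := lt_trans h h2.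
  by have := metric_triangle l (q (k1 n)).1.1 (Phi (q (k1 n)).1); lra.
have qE n : (q n).1 = ((q n).1.1, (q n).1.2) by case: (q n) => [[]].
have closing : closing_sequence Phi l (fun n => (q (k1 n)).1.1) (fun n => (q (k1 n)).1.2).
  split=> [n||]; first by have [] := qP (k1 n).
    move=> A /nbhs_ballP[d d0 dA]; apply: filterS (near_x d d0) => n.
    by rewrite mdist_ball => /dA.
  move=> A /nbhs_ballP[d d0 dA]; apply: filterS (near_xt d d0) => n.
  by rewrite mdist_ball qE => /dA.
have Cq n : C (q (k1 n)).1.1 by have [] := qP (k1 n).
have dir : homology_direction Phi nrm l (fun n => (q (k1 n)).1.1)
    (fun n => (q (k1 n)).1.2) (\pi_(D_X X) u).
  exists (fun n => (q (k1 n)).2), k2; split=> //; last first.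
    rewrite /cvg_ray unit_repr_pi // uE.
    have -> // : (fun n => nrm (unit_repr nrm (direction (q (k1 (k2 n))).2) - u)) =
        (fun n => nrm ((nrm (v (k2 n)))^-1 *: v (k2 n) - u)).
    by apply/funext => n; rewrite unit_repr_pi.
  move=> d d0; have d20 : 0 < d / 2 by rewrite divr_gt0.
  near=> n; have [_ _ _ _ [s [js rz]]] := qP (k1 n).
  have h1 : mdist l (Phi (q (k1 n)).1) < d / 2 by near: n; exact: near_xt.
  have h2 : (k1 n).+1%:R^-1 < d / 2 by near: n; exact: small.
  exists s; split; rewrite -?qE //; apply: (joins_ballS js).
  by rewrite lerBrDr; apply/ltW/(lt_le_trans (ltrD h1 h2)); lra.
have := fried _ _ _ _ closing Cq dir.
have [a a0 ->] := repr_ray u; rewrite pairingZ pmulr_rlt0 // => u0.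
(* A unit representative [w] this close to [u] would have negative pairing, while all the chosen
   loops pair nonnegatively. *)
have e0 : 0 < - pairing xi u / (B + 1) by rewrite divr_gt0 ?ltr_wpDl // oppr_gt0.
move/cvgrPdist_lt : k2u => /(_ _ e0) /filter_ex[n /=].
set w := _ *: _; rewrite sub0r normrN ger0_norm ?norm_ge0 //.
rewrite ltr_pdivlMr ?ltr_wpDl // mulrDr mulr1 [_ * B]mulrC => wu.
have w0 : 0 <= pairing xi w.
  rewrite /w pairingZ pairing_extend mulr_ge0 ?invr_ge0 ?norm_ge0 //.
  by have [_ _ _ h _] := qP (k1 (k2 n)); rewrite ler0z.
have := BP (w - u); rewrite pairingB ler_norml => /andP[_ h].
have := norm_ge0 hnrm (w - u); lra.
Unshelve. all: by end_near.
Qed.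

End Equivalence.

Theorem proposition1 (R : realType) (X : metricType R)
  (hX : finite_polyhedron R X) (xi : cohomology1 R X) (Phi : flow R X)
  (eps delta0 : R) (hscale : is_scale xi eps delta0)
  (nrm : homology1 R X R -> R) (hnrm : is_norm nrm)
  (hisol : isolated_in (R_xi xi Phi eps delta0) (chain_recurrent Phi)) :
  condition_B xi Phi eps delta0 <-> fried_condition xi Phi nrm eps delta0.
Proof.
have cX := polyhedron_compact hX; have star := polyhedron_star hX.
split; first exact: condition_B_fried.
exact: fried_condition_B.
Qed.
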